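(* Let $(X,\mu)$ be a standard Borel probability space with a fixed metric $\mathrm{d}$ on $X$ that induces its standard Borel structure. Let $G$ be a countable amenable group and let $T_G\curvearrowright(X,\mu)$ be a conservative action of $G$ by automorphisms. Let $\Gamma\curvearrowright(X,\mu)$ be a countable group of automorphisms and assume that $\Gamma$ is asymptotic for $T_G$. If the renormalization full-group satisfies $\mathrm{e}(\mathscr{R}(T_G;\Gamma))=\mathbb{R}$, then also $\mathrm{e}(T_G)=\mathbb{R}$. In particular, if $T_G$ is ergodic and $\mathrm{e}(\mathscr{R}(T_G;\Gamma))=\mathbb{R}$, then $T_G$ is of type $\mathrm{III}_1$.
   Context: An automorphism of $(X,\mu)$ is a bi-measurable bijection $V$ of $X$ onto $X$ with $\mu$ and $\mu\circ V^{-1}$ mutually absolutely continuous; $V'=\frac{d\mu\circ V}{d\mu}$. An action by automorphisms is a homomorphism into the group of automorphisms. Write $T_g$ for the automorphism of $g\in G$ and $\gamma x$ for the action of $\gamma\in\Gamma$. ''$g\to\infty$'' in $G$ means leaving every finite subset of $G$. $T_G$ is conservative if for every Borel set $E\subset X$ with $\mu(E)>0$ there exists $g\in G$, not the identity, with $\mu(E\cap T_gE)>0$; it is ergodic if every Borel set $E\subset X$ with $T_gE\subset E$ for all $g\in G$ satisfies $\mu(E)=0$ or $\mu(X\setminus E)=0$. $\Gamma$ is asymptotic for $T_G$ if for every $\gamma\in\Gamma$ and $\mu$-a.e. $x\in X$, $\mathrm{d}(T_g(x),T_g(\gamma x))\to0$ as $g\to\infty$. Full-group $[\Gamma]$: all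 automorphisms $V$ with $Vx\in\Gamma x$ for $\mu$-a.e. $x$. Maharam extension: $\widetilde{X}=X\times\mathbb{R}$ with $d\widetilde{\mu}(x,t)=d\mu(x)e^tdt$; an automorphism $V$ of $(X,\mu)$ extends to $\widetilde{V}(x,t)=(Vx,t-\log V'(x))$. Equip $\widetilde{X}$ with the product of $\mathrm{d}$ and the standard metric of $\mathbb{R}$. Renormalization full-group: $\mathscr{R}(T_G;\Gamma)$ is the set of all $V\in[\Gamma]$ such that for $\widetilde{\mu}$-a.e. $(x,t)$ the distance between $\widetilde{T_g}(x,t)$ and $\widetilde{T_g}(\widetilde{V}(x,t))$ tends to $0$ as $g\to\infty$. Since $\Gamma$ is asymptotic for $T_G$, this is equivalent to $\frac{(T_g\circ V)'(x)}{(T_g)'(x)}\to1$ as $g\to\infty$ for $\mu$-a.e. $x$. Its orbital equivalence relation is the countable Borel relation $\bigcup_{\gamma\in\Gamma}\{(x,\gamma x):\frac{(T_g\circ\gamma)'(x)}{(T_g)'(x)}\to1\text{ as }g\to\infty\}$. Ratio set $\mathrm{e}(\cdot)$: for a nonsingular countable Borel equivalence relation $\mathcal{R}$ on $(X,\mu)$, let $[[\mathcal{R}]]$ be the set of nonsingular one-to-one Borel maps $V:D\to V(D)$ with $D\subset X$ Borel and $(x,Vx)\in\mathcal{R}$ for $\mu$-a.e. $x\in D$. A number $r\in\mathbb{R}$ belongs to the ratio set if for every Borel $E$ with $\mu(E)>0$ and every $\epsilon>0$ there is $V\in[[\mathcal{R}]]$ with $\mu(E\cap V^{-1}E\cap\{|\log\frac{d\mu\circ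 V}{d\mu}-r|<\epsilon\})>0$. $\mathrm{e}(T_G)$ is the ratio set of the orbit equivalence relation of $T_G$, and $\mathrm{e}(\mathscr{R}(T_G;\Gamma))$ is that of the orbital equivalence relation of $\mathscr{R}(T_G;\Gamma)$. An ergodic action $T_G$ is of type $\mathrm{III}_1$ if $\mathrm{e}(T_G)=\mathbb{R}$.
   Formalization: Conservativity is strengthened: μ(E∩T_gE)>0 for infinitely many g (so G is infinite), not just one g≠1. As written the claim fails, e.g. for some actions of G=Z×Z/2 with Z/2 acting trivially; for essentially free actions the two notions agree. *)

(* Defs.v *)
From HB Require Import structures.
From mathcomp Require Import all_boot all_order all_algebra finmap.
From mathcomp Require Import all_classical all_reals all_analysis.

Set Implicit Arguments.
Unset Strict Implicit.
Unset Printing Implicit Defensive.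

Import Order.TTheory GRing.Theory Num.Theory.
Import numFieldNormedType.Exports.

Local Open Scope classical_set_scope.
Local Open Scope ring_scope.

HB.mixin Record Metric_isBorel (R : realType) (d : measure_display) X
    & Metric R X & Measurable d X := {
  borel_measurableE :
    @measurable d X = <<s [set A : set X | open A] >>
}.

(* A measurable space with a fixed metric inducing its Borel structure. The
   metric is not required to be complete. *)
#[short(type="borelMetricType")]
HB.structure Definition BorelMetric (R : realType) (d : measure_display) :=
  { X of Metric R X & Measurable d X & Metric_isBorel R d X }.

(* Borel isomorphic to a Polish space *)
Definition standard_borel (R : realType) (d : measure_display)
    (X : measurableType d) : Prop :=
  exists (Y : completePseudoMetricType R) (f : X -> Y),
    [/\ hausdorff_space Y, @second_countable Y, bijective f &
        forall A : set X,
          measurable A <-> <<s [set B : set Y | open B] >> (f @` A)].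

(* The filter of "g --> infinity" in a discrete group. *)
Definition at_infinity (G : Type) : set_system G :=
  [set A | cofinite_set A].
Arguments at_infinity : clear implicits.

Global Instance at_infinity_filter (G : Type) : Filter (at_infinity G).
Proof.
split; first exact: cofinite_setT.
- by move=> A B fA fB; rewrite /at_infinity/= setCI finite_setU.
- by move=> A B AB; exact: sub_cofinite_set.
Qed.

(* Foelner's condition, for left translations *)
Definition amenable (R : realType) (G : groupType) : Prop :=
  forall (K : {fset G}) (eps : R), 0 < eps ->
    exists2 F : {fset G}, F != fset0 &
      forall s, s \in K ->
        let sF := [fset (s * x)%g | x in F]%fset in
        (#|` sF `\` F|%fset + #|` F `\` sF|%fset)%:R <= eps * #|` F|%:R :> R.

Section nonsingular.
Context (R : realType) (d : measure_display) (X : measurableType d).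
Variable mu : probability X R.

(* The maps V : D -> V(D). Outside D = pdom the values of V are irrelevant.
   The Borel measurability of V(A) is automatic on standard Borel spaces
   (Lusin-Souslin); it is needed for mu (V(A)) to make sense. *)
Record partial_iso := PartialIso {
  pdom : set X;
  pfun :> X -> X;
  measurable_pdom : measurable pdom;
  measurable_pfun : measurable_fun pdom pfun;
  pfun_inj : {in pdom &, injective pfun};
  measurable_pfun_image : forall A, measurable A -> A `<=` pdom ->
    measurable (pfun @` A);
  pfun_nonsingular : forall A, measurable A -> A `<=` pdom ->
    mu (pfun @` A) = 0%E <-> mu A = 0%E
}.

(* mu \o V, extended by 0 outside the domain of V *)
Definition mu_comp (V : partial_iso) : set X -> \bar R :=
  fun A => mu (V @` (A `&` pdom V)).

Section mu_comp_measure.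
Variable V : partial_iso.

Let mV A : measurable A -> measurable (V @` (A `&` pdom V)).
Proof.
move=> mA; apply: measurable_pfun_image; last exact: subIsetr.
exact: measurableI (measurable_pdom V).
Qed.

Let mu_comp0 : mu_comp V set0 = 0%E.
Proof. by rewrite /mu_comp set0I image_set0 measure0. Qed.

Let mu_comp_ge0 A : (0 <= mu_comp V A)%E.
Proof. exact: measure_ge0. Qed.

Let mu_comp_sigma_additive : semi_sigma_additive (mu_comp V).
Proof.
move=> F mF tF mUF; rewrite /mu_comp setI_bigcupl image_bigcup.
apply: measure_semi_sigma_additive.
- by move=> n; exact: mV.
- apply/trivIsetP => i j _ _ ij; apply/seteqP; split => // y.
  move=> [] [x [Fx Dx] <-] [x' [Fx' Dx'] Vxx'].
  have xx' : x' = x by apply: pfun_inj Vxx'; rewrite inE.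
  rewrite xx' in Fx'.
  move/trivIsetP : tF => /(_ i j I I ij) Fij.
  by suff : set0 x by []; rewrite -Fij.
- rewrite -image_bigcup -setI_bigcupl; exact: mV.
Qed.

HB.instance Definition _ := isMeasure.Build _ _ _ (mu_comp V)
  mu_comp0 mu_comp_ge0 mu_comp_sigma_additive.

Let mu_comp_fin : fin_num_fun (mu_comp V).
Proof. by move=> A mA; apply: fin_num_measure; exact: mV. Qed.

HB.instance Definition _ := Measure_isFinite.Build _ _ _ (mu_comp V)
  mu_comp_fin.

End mu_comp_measure.

(* V' = d(mu \o V)/d(mu) *)
Definition derivative (V : partial_iso) (x : X) : R :=
  fine (Radon_Nikodym (charge_of_finite_measure (mu_comp V)) mu x).

Record automorphism := Automorphism {
  aut :> X -> X;
  aut_inv : X -> X;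
  autK : cancel aut aut_inv;
  aut_invK : cancel aut_inv aut;
  measurable_aut : measurable_fun [set: X] aut;
  measurable_aut_inv : measurable_fun [set: X] aut_inv;
  aut_dominates : pushforward mu aut `<< mu;
  aut_dominated : mu `<< pushforward mu aut
}.

Lemma aut_image (V : automorphism) (A : set X) : V @` A = aut_inv V @^-1` A.
Proof.
apply/seteqP; split => [_ [x Ax <-]|x Ax] /=; first by rewrite autK.
by exists (aut_inv V x) => //; rewrite aut_invK.
Qed.

Lemma measurable_aut_image (V : automorphism) (A : set X) :
  measurable A -> measurable (V @` A).
Proof.
by move=> mA; rewrite aut_image -[X in measurable X]setTI;
  exact: measurable_aut_inv.
Qed.

Lemma aut_nonsingular (V : automorphism) (A : set X) : measurable A ->
  mu (V @` A) = 0%E <-> mu A = 0%E.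
Proof.
move=> mA; have mVA := measurable_aut_image V mA.
have VK : V @^-1` (V @` A) = A.
  by rewrite aut_image; apply/seteqP; split => x /=; rewrite autK.
have pfm : forall B, pushforward mu V B = mu (V @^-1` B) by [].
split => [|mA0].
  move/(@measure0_null_setP _ _ _ mu _ mVA) => /(@aut_dominates V).
  by move=> /(_ _ mVA (@subset_refl _ _)); rewrite pfm VK.
have : (pushforward mu V).-null_set (V @` A).
  move=> B mB BVA; rewrite pfm; apply: (subset_measure0 _ mA _ mA0).
    by rewrite -[X in measurable X]setTI; exact: measurable_aut.
  by rewrite -VK => x /BVA.
by move/(@aut_dominated V) => /(_ _ mVA (@subset_refl _ _)).
Qed.

Lemma aut_eq (V W : automorphism) : V =1 W -> V = W.
Proof.
case: V W => [f f' fK f'K mf mf' f1 f2] [g g' gK g'K mg mg' g1 g2] /= fg.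
have {}fg : f = g by exact/funext.
have fg' : f' = g'.
  by apply/funext => x; rewrite -[x in LHS]g'K -fg fK.
by subst g g'; f_equal; exact: Prop_irrelevance.
Qed.

Section aut_partial.
Variable V : automorphism.

Let V_inj : {in [set: X] &, injective V}.
Proof. by move=> x y _ _; exact: (can_inj (autK V)). Qed.

Let V_image A : measurable A -> A `<=` [set: X] -> measurable (V @` A).
Proof. by move=> mA _; exact: measurable_aut_image. Qed.

Let V_nonsingular A : measurable A -> A `<=` [set: X] ->
  mu (V @` A) = 0%E <-> mu A = 0%E.
Proof. by move=> mA _; exact: aut_nonsingular. Qed.

Definition aut_partial : partial_iso :=
  @PartialIso [set: X] V measurableT (measurable_aut V) V_inj V_image
    V_nonsingular.

End aut_partial.

Lemma aut_preimage_nonsingular (V : automorphism) (A : set X) :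
  measurable A -> mu (V @^-1` A) = 0%E <-> mu A = 0%E.
Proof.
move=> mA; have mVA : measurable (V @^-1` A).
  by rewrite -[X in measurable X]setTI; exact: measurable_aut.
rewrite -(aut_nonsingular V mVA); suff -> : V @` (V @^-1` A) = A by [].
by rewrite aut_image; apply/seteqP; split => x /=; rewrite aut_invK.
Qed.

(* The automorphisms form a group under composition, (V * W) x = V (W x). *)
Section aut_group.

Let nonsingularP (f : X -> X) :
  (forall A, measurable A -> mu (f @^-1` A) = 0%E <-> mu A = 0%E) ->
  pushforward mu f `<< mu /\ mu `<< pushforward mu f.
Proof.
move=> fns; split => A A0 B mB BA; first by apply/(fns _ mB); exact: A0.
by apply/(fns _ mB); exact: (A0 _ mB BA).
Qed.

Let one_nonsingular : pushforward mu idfun `<< mu /\ mu `<< pushforward mu idfun.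
Proof. by apply: nonsingularP. Qed.

Let mul_nonsingular (V W : automorphism) :
  pushforward mu (V \o W) `<< mu /\ mu `<< pushforward mu (V \o W).
Proof.
apply: nonsingularP => A mA.
rewrite comp_preimage aut_preimage_nonsingular ?aut_preimage_nonsingular//.
by rewrite -[X in measurable X]setTI; exact: measurable_aut.
Qed.

Let inv_nonsingular (V : automorphism) :
  pushforward mu (aut_inv V) `<< mu /\ mu `<< pushforward mu (aut_inv V).
Proof.
by apply: nonsingularP => A mA; rewrite -aut_image; exact: aut_nonsingular.
Qed.

Let mul_can (V W : automorphism) :
  cancel (V \o W) (aut_inv W \o aut_inv V).
Proof. by move=> x /=; rewrite !autK. Qed.

Let mul_invcan (V W : automorphism) :
  cancel (aut_inv W \o aut_inv V) (V \o W).
Proof. by move=> x /=; rewrite !aut_invK. Qed.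

Definition aut_one : automorphism :=
  @Automorphism idfun idfun (fun=> erefl) (fun=> erefl)
    (@measurable_id _ _ _) (@measurable_id _ _ _)
    (proj1 one_nonsingular) (proj2 one_nonsingular).

Definition aut_mul (V W : automorphism) : automorphism :=
  @Automorphism (V \o W) (aut_inv W \o aut_inv V)
    (@mul_can V W) (@mul_invcan V W)
    (measurableT_comp (measurable_aut V) (measurable_aut W))
    (measurableT_comp (measurable_aut_inv W) (measurable_aut_inv V))
    (proj1 (mul_nonsingular V W)) (proj2 (mul_nonsingular V W)).

Definition aut_invg (V : automorphism) : automorphism :=
  @Automorphism (aut_inv V) V (aut_invK V) (autK V)
    (measurable_aut_inv V) (measurable_aut V)
    (proj1 (inv_nonsingular V)) (proj2 (inv_nonsingular V)).

End aut_group.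
End nonsingular.

Section aut_groupType.
Context (R : realType) (d : measure_display) (X : measurableType d).
Variable mu : probability X R.

HB.instance Definition _ := gen_eqMixin (automorphism mu).
HB.instance Definition _ := gen_choiceMixin (automorphism mu).

Let aut_mulA : associative (@aut_mul R d X mu).
Proof. by move=> U V W; exact: aut_eq. Qed.

Let aut_mul1 : left_id (aut_one mu) (@aut_mul R d X mu).
Proof. by move=> V; exact: aut_eq. Qed.

Let aut_mulr1 : right_id (aut_one mu) (@aut_mul R d X mu).
Proof. by move=> V; exact: aut_eq. Qed.

Let aut_mulV : left_inverse (aut_one mu) (@aut_invg R d X mu)
  (@aut_mul R d X mu).
Proof. by move=> V; apply: aut_eq => x /=; rewrite autK. Qed.

Let aut_mulrV : right_inverse (aut_one mu) (@aut_invg R d X mu)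
  (@aut_mul R d X mu).
Proof. by move=> V; apply: aut_eq => x /=; rewrite aut_invK. Qed.

HB.instance Definition _ := isGroup.Build (automorphism mu)
  aut_mulA aut_mul1 aut_mulr1 aut_mulV aut_mulrV.

End aut_groupType.

Section actions.
Context (R : realType) (d : measure_display) (X : measurableType d).
Variable mu : probability X R.

(* Recurrence is required for g outside any finite subset of G, not merely for
   one g <> 1: the latter also holds for every action of Z x Z/2 in which Z/2
   acts trivially, even if Z acts by a wandering translation. For an
   essentially free action, or a torsion-free G, the two are equivalent. *)
Definition conservative (G : groupType)
    (T : {multiplicative G -> automorphism mu}) : Prop :=
  forall E : set X, measurable E -> (0 < mu E)%E ->
    infinite_set [set g | (0 < mu (E `&` T g @` E))%E].

Definition ergodic (G : groupType)
    (T : {multiplicative G -> automorphism mu}) : Prop :=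
  forall E : set X, measurable E -> (forall g, T g @` E `<=` E) ->
    mu E = 0%E \/ mu (~` E) = 0%E.

Definition ratio_set (rel : X -> X -> Prop) : set R :=
  [set r | forall E : set X, measurable E -> (0 < mu E)%E ->
    forall eps : R, 0 < eps ->
    exists2 V : partial_iso mu,
      {ae mu, forall x, pdom V x -> rel x (V x)} &
      (0 < mu (pdom V `&` E `&` V @^-1` E `&`
               [set x | (`|ln (derivative V x) - r| < eps)%R]))%E].

Definition orbit_relation (G : groupType)
    (T : {multiplicative G -> automorphism mu}) (x y : X) : Prop :=
  exists g, y = T g x.

Definition type_III1 (G : groupType)
    (T : {multiplicative G -> automorphism mu}) : Prop :=
  ergodic T /\ ratio_set (orbit_relation T) = [set: R].

(* The orbital equivalence relation of the renormalization full-group of T, S.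
   For V in the full-group of S, the Maharam extensions of T_g asymptotically
   identify (x, t) and its image under that of V for a.e. (x, t) if and only if
   (x, V x) is in this relation for a.e. x, provided S is asymptotic for T. *)
Definition renormalization_relation (G Gam : groupType)
    (T : {multiplicative G -> automorphism mu})
    (S : {multiplicative Gam -> automorphism mu}) (x y : X) : Prop :=
  exists2 gam : Gam, y = S gam x &
    (fun g => derivative (aut_partial (T g * S gam)%g) x /
              derivative (aut_partial (T g)) x) @ at_infinity G --> (1 : R).

End actions.

Definition asymptotic (R : realType) (d : measure_display)
    (X : borelMetricType R d) (mu : probability X R) (G Gam : groupType)
    (T : {multiplicative G -> automorphism mu})
    (S : {multiplicative Gam -> automorphism mu}) : Prop :=
  forall gam : Gam, {ae mu, forall x,
    (fun g => mdist (T g x : X) (T g (S gam x))) @ at_infinity G --> (0 : R)}.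

(* Main.v *)
Require Import Defs.
From mathcomp Require Import all_boot all_order all_algebra finmap.
From mathcomp Require Import all_classical all_reals all_analysis.
From mathcomp Require Import measurable_realfun lra ring zify.

(** If [r] is not in the ratio set of the orbit relation of [T], then some
    non-null [E] has no return [T g x] with [ln (T_g)' x] within [eps] of [r].
    Call [height g x] the number [ln (T_g)' x], and let [A] be the set of points
    which return to [E] at a height of absolute value less than [eps / 2]. If
    [x] and [y = S gam x] lie in [E] and [y] is asymptotic to [x] with heights
    shifted by [r], then [T g x] is in [A] and [T g y] is not in [A], for all
    but finitely many [g] with [height g x] close to [0]. This contradicts
    [T g x] and [T g y] becoming close, once [A] is approximated, up to a set
    [Q] of small measure, by sets at positive distance from each other: the
    [g] with small height and [T g x] or [T g y] in [Q] must be negligible.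

    No pointwise ratio ergodic theorem is available for amenable groups. Instead,
    take a Foelner set [C] and average over the set [C c^-1], for [c] uniformly
    distributed in [C]. For most [c] this set contains any given finite set, and
    the frequency of visits to [Q] among the heights near [0] has, on average
    over [x] and [c], at most a constant times the measure of [Q]: spreading the
    mass of [x] over the points [T (b c^-1) x] for [b] in [C] is reversed by
    exchanging [b] and [c]. The same inequality shows that a conservative action
    returns infinitely often to the heights near [0]. *)

Set Implicit Arguments.
Unset Strict Implicit.
Unset Printing Implicit Defensive.

Import Order.TTheory GRing.Theory Num.Theory.
Import numFieldNormedType.Exports.

Local Open Scope classical_set_scope.
Local Open Scope ring_scope.

(** * A weighted counting inequality on the real line *)

Section clusters.
Context (R : realType).
Implicit Types (s : seq R) (m c k t : R).

(** The sum of the geometric series [expR (m - k * t)], [k >= 0]: one term for each cluster removed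
    in the proof below. *)
Definition cluster_const (m t : R) : R := expR m / (1 - expR (- t)).

Lemma cluster_const_ge0 m t : 0 < t -> 0 <= cluster_const m t.
Proof.
move=> t0; rewrite divr_ge0 ?expR_ge0// subr_ge0 -[leRHS]expR0 ler_expR.
by rewrite oppr_le0 ltW.
Qed.

(* The points of [s] within distance [t] below the highest point [<= m]
   contribute at most [expR m]; remove them and replace [m] by [m - t]. *)
Lemma sum_expR_cluster s m t : 0 < t ->
  \sum_(c <- s | c <= m) expR c / (count (fun k => `|k - c| <= t) s)%:R
  <= cluster_const m t.
Proof.
move=> t0; have q1 : expR (- t) < 1 by rewrite -[ltRHS]expR0 ltr_expR oppr_lt0.
have [n] := ubnP (size s); elim: n s m => // n IH s m /ltnSE sn.
have [/hasP[c1 c1s c1m]|/hasPn no] := boolP (has (fun c => c <= m) s); last first.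
  rewrite big_seq_cond big1 ?cluster_const_ge0// => c /andP[/no /negP//].
pose M := \big[Num.max/c1]_(c <- s | c <= m) c.
have Mub c : c \in s -> c <= m -> c <= M.
  by move=> cs cm; rewrite /M; apply: le_bigmax_seq.
have Mm : M <= m by rewrite /M; elim/big_ind: _ => // x y xm ym; rewrite ge_max xm.
have Ms : M \in s.
  rewrite /M big_seq_cond; elim/big_ind: _ => //; last by move=> i /andP[].
  by move=> x y xs ys; rewrite maxEle; case: ifP.
pose S0 := [pred c | M - t <= c <= M].
pose s' := [seq c <- s | ~~ S0 c].
have s's : (size s' < size s)%N.
  rewrite size_filter -(count_predC S0 s) addnC -[ltnLHS]addn0 ltn_add2l.
  by rewrite -has_count; apply/hasP; exists M => //=; rewrite lexx andbT gerBl ltW.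
rewrite (bigID S0)/=.
have -> : cluster_const m t = expR m + cluster_const (m - t) t.
  rewrite /cluster_const expRD; field.
  by rewrite subr_eq0 eq_sym lt_eqF.
apply: lerD.
  have S0n : (0 < count S0 s)%N.
    by rewrite -has_count; apply/hasP; exists M => //=; rewrite lexx andbT gerBl ltW.
  apply: (@le_trans _ _ (\sum_(c <- s | S0 c) expR m / (count S0 s)%:R)).
    rewrite [leRHS](bigID (fun c => c <= m))/= ler_wpDr//.
      by apply: sumr_ge0 => c _; rewrite divr_ge0// expR_ge0.
    rewrite big_seq_cond [leRHS]big_seq_cond.
    rewrite [leRHS](eq_bigl (fun c => [&& c \in s, c <= m & S0 c])); last first.
      by move=> c; congr (_ && _); rewrite andbC.
    apply: ler_sum => c /and3P[cs cm /andP[c1' c2']].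
    (* Two points of the window [[M - t, M]] are within [t] of each other, so each denominator is at
       least [count S0 s]. *)
    rewrite ler_pM ?expR_ge0 ?invr_ge0 ?ler_expR// lef_pV2 ?posrE ?ltr0n//.
      rewrite ler_nat; apply: sub_count => k /andP[k1 k2].
      by rewrite ler_norml; apply/andP; split; lra.
    by rewrite -has_count; apply/hasP; exists c => //; rewrite subrr normr0 ltW.
  rewrite big_const_seq iter_addr_0 -[X in _ *+ X]/(count S0 s).
  rewrite -[leLHS]mulr_natr divfK//.
  by rewrite pnatr_eq0 -lt0n.
(* A point [<= m] outside the window lies below [M - t <= m - t], and deleting the window can only
   decrease the remaining denominators. *)
apply: le_trans (IH s' (m - t) (leq_trans s's sn)).
rewrite /s' big_filter_cond/= big_seq_cond [leRHS]big_seq_cond.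
rewrite (eq_bigl (fun c => [&& c \in s, c <= m & ~~ S0 c]))//.
rewrite [leRHS](eq_bigl (fun c => [&& c \in s, c <= m & ~~ S0 c])); last first.
  move=> c; apply/and3P/and3P => -[cs].
    by move=> nS cm; split=> //; move: cm t0; clear; lra.
  move=> cm nS; split=> //; have := Mub _ cs cm => cM.
  by move: nS; rewrite /= cM andbT -ltNge => ?; lra.
apply: ler_sum => c /and3P[cs cm nS].
rewrite ler_pM2l ?expR_gt0// lef_pV2 ?posrE ?ltr0n -?has_count.
- by rewrite ler_nat count_filter sub_count// => k /andP[].
- by apply/hasP; exists c => //; rewrite subrr normr0 ltW.
- by apply/hasP; exists c; rewrite ?mem_filter ?nS// subrr normr0 ltW.
Qed.

End clusters.

(** * Countable quantifiers and coincidence sets *)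

Section countable_families.

Lemma countable_enum (J : Type) : J -> countable [set: J] ->
  exists e : nat -> J, forall i, exists n, e n = i.
Proof.
move=> i0 /pfcard_geP[I0|[f]].
  by have : [set: J] i0 by []; rewrite I0.
by exists f => i; have [n _ <-] := @surj _ _ _ _ f i I; exists n.
Qed.

Context (R : realType) (d : measure_display) (X : measurableType d).
Variable mu : probability X R.

Lemma countable_bigcapT_measurable (J : Type) (F : J -> set X) :
  countable [set: J] -> (forall i, measurable (F i)) ->
  measurable (\bigcap_i F i).
Proof.
move=> cI mF; rewrite -[X in measurable X]setCK; apply: measurableC.
rewrite setC_bigcap; apply: countable_bigcupT_measurable => // i.
exact: measurableC.
Qed.

Lemma ae_forall_countable (J : Type) (P : J -> X -> Prop) :
  countable [set: J] -> (forall i, {ae mu, forall x, P i x}) ->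
  {ae mu, forall x, forall i, P i x}.
Proof.
move=> cI aeP; have [[i0]|nI] := pselect (inhabited J); last first.
  by apply: aeW => x i; exfalso; apply: nI; exists.
have [e eP] := countable_enum i0 cI.
have := @ae_foralln _ _ _ mu (fun n => P (e n)) (fun n => aeP (e n)).
by apply: filterS => x Px i; have [n <-] := eP i.
Qed.

(** In a Polish model, distinct points are separated by a member of a countable base, so [f] and [g]
    differ on a countable union of measurable sets. *)
Lemma measurable_eq_standard_borel (D : set X) (f g : X -> X) :
  standard_borel R X -> measurable D -> measurable_fun D f ->
  measurable_fun D g -> measurable (D `&` [set x | f x = g x]).
Proof.
move=> [Y [h [hY [B cB [oB bB]] bh hE]]] mD mf mg.
have mh U : B U -> measurable (h @^-1` U).
  move=> BU; apply/hE; rewrite image_preimage; last first.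
    by have [h' _ hK] := bh; apply/seteqP; split => // y _; exists (h' y).
  by apply: sub_sigma_algebra; exact: oB.
have -> : D `&` [set x | f x = g x] = D `\`
    \bigcup_(U in B) ((D `&` f @^-1` (h @^-1` U)) `\` (D `&` g @^-1` (h @^-1` U))).
  apply/seteqP; split => x.
    by move=> [Dx /= fg]; split => // -[U BU [[_]] /=]; rewrite fg => ? [].
  move=> [Dx nU]; split => //=; apply: contrapT => fg.
  have hfg : h (f x) != h (g x).
    by apply/eqP => /(bij_inj bh).
  move: hY; rewrite open_hausdorff => /(_ _ _ hfg)[[U W]]/= [].
  rewrite !inE => Ux Wx [oU oW UW].
  have [V [BV Vx] VU] := bB (h (f x)) U (open_nbhs_nbhs (conj oU Ux)).
  apply: nU; exists V => //; split => // -[_ /VU Ux'].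
  by suff : set0 (h (g x)) by []; rewrite -UW.
apply: measurableD => //.
have [->|[e]] := pfcard_geP cB; first by rewrite bigcup_set0.
rewrite (_ : \bigcup_(U in B) _ = \bigcup_n
    ((D `&` f @^-1` (h @^-1` (e n))) `\` (D `&` g @^-1` (h @^-1` (e n))))).
  apply: bigcup_measurable => n _; have Be : B (e n) by exact: funS.
  by apply: measurableD; [apply: mf|apply: mg] => //; exact: mh.
apply/seteqP; split => x [].
  by move=> U BU; have [n _ <-] := @surj _ _ _ _ e U BU; exists n.
by move=> n _ ?; exists (e n) => //; exact: funS.
Qed.

End countable_families.

(** * Exhaustion by increasing sequences of sets *)

Section exhaustion.
Context (R : realType) (d : measure_display) (X : measurableType d).
Variable mu : probability X R.

(** Continuity from below. It serves to replace a finite subset of [G] depending on the point by a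
    single one, at a small loss of measure. *)
Lemma exhaustion_gt (F : (set X)^nat) (a : \bar R) :
  (forall n, measurable (F n)) -> nondecreasing_seq F ->
  (a < mu (\bigcup_n F n))%E -> exists n, (a < mu (F n))%E.
Proof.
move=> mF ndF aF.
have mUF : measurable (\bigcup_n F n) by exact: bigcup_measurable.
have cF := @nondecreasing_cvg_mu _ _ _ mu _ mF mUF ndF.
move: cF => /(_ _ (open_ereal_gt' aF))[n _ /(_ n (leqnn n))/= an].
by exists n.
Qed.

Lemma exhaustion_lt (F : (set X)^nat) (e : R) :
  (forall n, measurable (F n)) -> nondecreasing_seq F -> 0 < e ->
  exists n, (mu ((\bigcup_n F n) `\` F n) < e%:E)%E.
Proof.
move=> mF ndF e0; pose U := \bigcup_n F n.
have mU : measurable U by exact: bigcup_measurable.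
have mD n : measurable (U `\` F n) by exact: measurableD.
have D0 : \bigcap_n (U `\` F n) = set0.
  rewrite -subset0 => x Dx; have [[n _ Fx] _] := Dx 0%N I.
  by have [_] := Dx n I; apply.
have : mu (U `\` F n) @[n --> \oo] --> mu (\bigcap_n (U `\` F n)).
  apply: nonincreasing_cvg_mu => //.
  - by rewrite -ge0_fin_numE// fin_num_measure.
  - by apply: bigcap_measurable => //; exists 0%N.
  - move=> m n mn; apply/subsetPset => x [Ux nFn]; split=> // Fm; apply: nFn;
      by have /subsetPset := ndF _ _ mn; apply.
rewrite D0 measure0 => cD.
have e0' : (0 < e%:E)%E by rewrite lte_fin.
have [n _ /(_ n (leqnn n))/= Dn] := cD _ (open_ereal_lt' e0').
by exists n.
Qed.

Lemma ae_le_measure (A B : set X) : measurable A -> measurable B ->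
  {ae mu, forall x, A x -> B x} -> (mu A <= mu B)%E.
Proof.
move=> mA mB [N [mN N0 AB]]; apply: (@le_trans _ _ (mu (B `|` N))).
  apply: le_measure; rewrite ?inE//; first exact: measurableU.
  move=> x Ax; have [Bx|nBx] := pselect (B x); [by left|right].
  by apply: AB => /(_ Ax).
apply: (le_trans (measureU2 mu mB mN)).
by rewrite -[leRHS]adde0 leeD2l//; move/eqP: N0; rewrite -measure_le0.
Qed.

End exhaustion.

(** * Finite sets and the Foelner condition *)

Section finite_families.

Lemma count_uniq_subset (I : eqType) (P : pred I) (s r : seq I) :
  uniq s -> {subset s <= r} -> (count P s <= count P r)%N.
Proof.
move=> us sr; rewrite -!size_filter uniq_leq_size ?filter_uniq// => i.
by rewrite !mem_filter => /andP[-> /sr].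
Qed.

Lemma exhausting_seqs (I : choiceType) : I -> countable [set: I] ->
  exists K : nat -> seq I, [/\ forall n, uniq (K n),
    forall m n, (m <= n)%N -> {subset K m <= K n} &
    forall s : seq I, exists n, {subset s <= K n}].
Proof.
move=> i0 cI; have [e eP] := countable_enum i0 cI.
exists (fun n => undup [seq e k | k <- iota 0 n]); split => [n|m n mn i|s].
- exact: undup_uniq.
- rewrite !mem_undup => /mapP[k]; rewrite mem_iota /= add0n => km ->.
  by apply: map_f; rewrite mem_iota /= add0n (leq_trans km).
- elim: s => [|i s [n IH]]; first by exists 0%N.
  have [k <-] := eP i; exists (maxn n k.+1) => j; rewrite inE => /predU1P[->|/IH].
    by rewrite mem_undup map_f// mem_iota /= add0n leq_max leqnn orbT.
  rewrite !mem_undup => /mapP[l]; rewrite mem_iota /= add0n => ln ->.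
  by rewrite map_f// mem_iota /= add0n leq_max ln.
Qed.

Lemma seq_argmax (R : realType) (I : eqType) (f : I -> R) (s : seq I) i :
  i \in s -> exists2 j, j \in s & forall k, k \in s -> f k <= f j.
Proof.
elim: s i => // j s IH i _; case: s IH => [_|k s IH].
  by exists j => [|k]; rewrite ?mem_head// inE => /eqP ->.
have [l ls lmax] := IH k (mem_head _ _).
have [jl|lj] := leP (f j) (f l).
  exists l; first by rewrite inE ls orbT.
  by move=> i'; rewrite inE => /predU1P[->//|/lmax].
exists j; first by rewrite mem_head.
move=> i'; rewrite inE => /predU1P[->//|/lmax/le_trans]; apply; exact: ltW.
Qed.

Lemma finite_set_seq (I : choiceType) (A : set I) : finite_set A ->
  exists s : seq I, forall i, A i <-> i \in s.
Proof. by move=> /finite_fsetP[F ->]; exists F => i. Qed.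

(** A union bound over [K]: translation by [s] injects the [c] in [C] with [s * c] outside [C] into
    [sC \ C], which is small by Foelner's condition. *)
Lemma folner_seq (R : realType) (G : groupType) : amenable R G ->
  forall (K : seq G) (e : R), 0 < e -> exists2 C : {fset G}, (0 < size C)%N &
  (count (fun c => ~~ all (fun s => (s * c)%g \in C) K) C)%:R <=
    e * (size C)%:R.
Proof.
move=> aG K e e0.
(* [e] is shared among the elements of [K]; the successor keeps the divisor nonzero when [K] is
   empty. *)
have e'0 : 0 < e / (size K).+1%:R by rewrite divr_gt0.
have [C C0 CP] := aG [fset x in K]%fset _ e'0.
exists C; first by rewrite -[size _]/(#|` C|)%fset cardfs_gt0.
have countK : (count (fun c => ~~ all (fun s => (s * c)%g \in C) K) C <=
    \sum_(s <- K) count (fun c => (s * c)%g \notin C) C)%N.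
  elim: K {e'0 CP} => [|s K IH].
    by rewrite big_nil (@eq_count _ _ pred0)// count_pred0.
  rewrite big_cons (leq_trans _ (leq_add (leqnn _) IH))//.
  rewrite -count_predUI (leq_trans _ (leq_addr _ _))//; apply: sub_count => c /=.
  by rewrite negb_and.
apply: (@le_trans _ _ (\sum_(s <- K) (e / (size K).+1%:R * (size C)%:R))).
  rewrite (le_trans
    (y := \sum_(s <- K) (count (fun c => (s * c)%g \notin C) C)%:R))//.
    by rewrite -natr_sum ler_nat.
  rewrite big_seq [leRHS]big_seq; apply: ler_sum => s sK.
  have sK' : s \in [fset x in K]%fset by rewrite inE.
  have /= := CP s sK'; apply: le_trans; rewrite ler_nat.
  apply: leq_trans (leq_addr _ _).
  rewrite -size_filter -(size_map (fun c => s * c)%g).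
  apply: uniq_leq_size.
    by rewrite map_inj_uniq ?filter_uniq ?fset_uniq//; exact: mulgI.
  move=> g /mapP[c]; rewrite mem_filter => /andP[scC cC] ->.
  by rewrite in_fsetD scC/=; apply/imfsetP; exists c.
rewrite big_const_seq count_predT iter_addr_0 -[leLHS]mulr_natr.
rewrite mulrAC ler_wpM2r// -mulrA ler_piMr ?(ltW e0)//.
by rewrite mulrC ler_pdivrMr// mul1r ler_nat.
Qed.

End finite_families.

(** * Radon-Nikodym derivatives of nonsingular maps *)

Section derivative.
Context (R : realType) (d : measure_display) (X : measurableType d).
Variable mu : probability X R.
Implicit Types (V : partial_iso mu) (U W : automorphism mu).

Lemma mu_comp_dominates V : mu_comp V `<< mu.
Proof.
move=> N N0 A mA AN; have mAV := measurableI _ _ mA (measurable_pdom V).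
apply: (pfun_nonsingular mAV (@subIsetr _ _ _)).2.
by apply: N0 => //; apply: subset_trans AN; exact: subIsetl.
Qed.

Lemma derivativeE V x : (derivative V x)%:E =
  Radon_Nikodym (charge_of_finite_measure (mu_comp V)) mu x.
Proof. by rewrite fineK// Radon_Nikodym_fin_num//; exact: mu_comp_dominates. Qed.

Lemma measurable_derivative V : measurable_fun [set: X] (derivative V).
Proof.
apply/measurable_EFinP; rewrite (funext (derivativeE V) : EFin \o _ = _).
exact/measurable_int/Radon_Nikodym_integrable/mu_comp_dominates.
Qed.

Lemma integrable_derivative V :
  mu.-integrable [set: X] (fun x => (derivative V x)%:E).
Proof.
under eq_fun do rewrite derivativeE.
exact/Radon_Nikodym_integrable/mu_comp_dominates.
Qed.

Lemma integral_derivative V A : measurable A ->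
  (\int[mu]_(x in A) (derivative V x)%:E)%E = mu (V @` (A `&` pdom V)).
Proof.
move=> mA; under eq_integral do rewrite derivativeE.
rewrite -Radon_Nikodym_integral//; exact: mu_comp_dominates.
Qed.

Lemma derivative_ae_unique V D (g : X -> R) : measurable D ->
  measurable_fun D g ->
  (forall A, measurable A -> A `<=` D ->
    (\int[mu]_(x in A) (g x)%:E)%E = mu (V @` (A `&` pdom V))) ->
  {ae mu, forall x, D x -> derivative V x = g x}.
Proof.
move=> mD mg gE.
suff : ae_eq mu D (fun x => (derivative V x)%:E) (EFin \o g).
  by apply: filterS => x /= /[apply]-[].
apply: integral_ae_eq => //.
- exact: integrableS (integrable_derivative V).
- exact/measurable_EFinP.
- by move=> A AD mA; rewrite integral_derivative// gE.
Qed.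

(** Change of variables: the derivative is the density of [mu_comp V], whose image under [W] is
    [mu]. *)
Lemma integral_comp_derivative W (f : X -> \bar R) :
  measurable_fun [set: X] f -> (forall x, 0 <= f x)%E ->
  (\int[mu]_x (f (W x) * (derivative (aut_partial W) x)%:E) =
   \int[mu]_x f x)%E.
Proof.
move=> mf f0; set V := aut_partial W.
have mW : measurable_fun [set: X] W := measurable_aut W.
have mfW : measurable_fun [set: X] (f \o W) by exact: measurableT_comp.
transitivity (\int[mu]_x ((f \o W) x *
    Radon_Nikodym_SigmaFinite.f (mu_comp V) mu x))%E.
  apply: ae_eq_integral => //.
  - apply: emeasurable_funM => //; apply/measurable_EFinP.
    exact: measurable_derivative.
  - apply: emeasurable_funM => //.
    exact/measurable_int/Radon_Nikodym_SigmaFinite.f_integrable/mu_comp_dominates.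
  - apply: ae_eqe_mul2l; apply: ae_eq_sym.
    under [X in ae_eq _ _ _ X]eq_fun do rewrite derivativeE.
    by apply: ae_eq_Radon_Nikodym_SigmaFinite => //; exact: mu_comp_dominates.
rewrite Radon_Nikodym_SigmaFinite.change_of_variables//; last first.
  by move=> x; exact: f0.
  exact: mu_comp_dominates.
rewrite -(ge0_integral_pushforward mW (mu_comp V) measurableT)//.
apply: eq_measure_integral => A mA _.
transitivity (mu (W @` (W @^-1` A `&` setT))) => //; rewrite setIT; congr (mu _).
by rewrite aut_image; apply/seteqP; split => x /=; rewrite aut_invK.
Qed.

(** The image of the set [N] where the derivative is [<= 0] has measure at most [0], so [N] is null
    by nonsingularity. *)
Lemma derivative_gt0 W :
  {ae mu, forall x, 0 < derivative (aut_partial W) x}.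
Proof.
set D := derivative _; pose N := D @^-1` `]-oo, 0].
have mN : measurable N.
  by rewrite -[X in measurable X]setTI; exact: measurable_derivative.
exists N; split => //; last by move=> x /negP; rewrite -leNgt /N /= in_itv.
apply/(aut_nonsingular W mN)/eqP; rewrite -measure_le0.
have := integral_derivative (aut_partial W) mN; rewrite setIT/= => <-.
rewrite -[leRHS](integral0 mu N); apply: le_integral => //.
- exact: integrableS (integrable_derivative _).
- exact: integrable0.
- by move=> x; rewrite inE /N/= in_itv/= lee_fin.
Qed.

Lemma ae_aut_comp W (P : X -> Prop) :
  {ae mu, forall x, P x} -> {ae mu, forall x, P (W x)}.
Proof.
move=> [N [mN N0 PN]]; exists (W @^-1` N); split.
- by rewrite -[X in measurable X]setTI; exact: measurable_aut.
- exact: (aut_preimage_nonsingular W mN).2.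
- by move=> x /= nPW; exact: PN.
Qed.

(** The chain rule: by uniqueness of densities it suffices to compare integrals, where
    [integral_comp_derivative] applies. *)
Lemma derivative_aut_mul U W : {ae mu, forall x,
  derivative (aut_partial (aut_mul U W)) x =
  derivative (aut_partial U) (W x) * derivative (aut_partial W) x}.
Proof.
have mDW : measurable_fun setT (fun x => derivative (aut_partial U) (W x)).
  by apply: measurableT_comp (measurable_aut W); exact: measurable_derivative.
(* Truncation by [Num.max 0] makes the factor nonnegative everywhere, as the change of variables
   requires, and alters it only on a null set. *)
suff : {ae mu, forall x, [set: X] x ->
    derivative (aut_partial (aut_mul U W)) x =
    Num.max 0 (derivative (aut_partial U) (W x)) * derivative (aut_partial W) x}.
  have := ae_aut_comp W (derivative_gt0 U).
  by apply: filterS2 => x D0 /(_ I) ->; rewrite max_r// ltW.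
apply: derivative_ae_unique => //.
  apply: measurable_funM; last exact: measurable_derivative.
  exact: measurable_maxr.
move=> A mA _; rewrite setIT/=.
have -> : aut_mul U W @` A = U @` (W @` A) by rewrite image_comp.
have mWA : measurable (W @` A) by exact: measurable_aut_image.
have := integral_derivative (aut_partial U) mWA; rewrite setIT/= => <-.
have -> : (\int[mu]_(x in W @` A) (derivative (aut_partial U) x)%:E =
    \int[mu]_(x in W @` A) (Num.max 0 (derivative (aut_partial U) x))%:E)%E.
  apply: ae_eq_integral => //.
  - by apply/measurable_EFinP/measurable_funTS/measurable_derivative.
  - apply/measurable_EFinP/measurable_funTS.
    by apply: measurable_maxr => //; exact: measurable_derivative.
  - have := derivative_gt0 U; apply: filterS => x D0 _.
    by rewrite max_r// ltW.
rewrite [RHS]integral_mkcond -[RHS](integral_comp_derivative W)//; last 2 first.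
- apply/(measurable_restrictT _ mWA)/measurable_EFinP/measurable_funTS.
  by apply: measurable_maxr => //; exact: measurable_derivative.
- by move=> x; rewrite patchE; case: ifPn => // _; rewrite lee_fin le_max lexx.
rewrite [LHS]integral_mkcond; apply: eq_integral => x _.
rewrite !patchE; have -> : (W x \in W @` A) = (x \in A).
  apply/idP/idP; rewrite !inE; last by move=> Ax; exists x.
  by move=> [y Ay /(can_inj (autK W)) <-].
by case: ifPn; rewrite ?mul0e.
Qed.

Lemma derivative_ae_eq_aut V W D : measurable D -> D `<=` pdom V ->
  {in D, V =1 W} ->
  {ae mu, forall x, D x -> derivative V x = derivative (aut_partial W) x}.
Proof.
move=> mD DV VW; apply: derivative_ae_unique => //.
  exact/measurable_funTS/measurable_derivative.
move=> A mA AD; rewrite integral_derivative// setIT/=; congr (mu _).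
rewrite setIidl; last exact: subset_trans DV.
by apply: eq_imagel => x Ax; rewrite VW// inE; exact: AD.
Qed.

End derivative.

(** * Approximation of Borel sets by sets at positive distance *)

Section borel_metric.
Context (R : realType) (d : measure_display) (X : borelMetricType R d).
Variable mu : probability X R.
Implicit Types (A B : set X) (e t : R).

(* Sets at positive distance stand in for uniformly continuous functions: [X]
   is not known to be separable, so that [mdist (f x) (g x)] might not be
   measurable for measurable [f] and [g]. *)
Definition separated_approx e A := exists Z1 Z0 t, [/\ 0 < t,
  measurable Z1, measurable Z0,
  forall x y, Z1 x -> Z0 y -> t <= mdist x y &
  (mu (A `\` Z1) < e%:E)%E /\ (mu (~` A `\` Z0) < e%:E)%E].

Lemma separated_approxC e A : separated_approx e A -> separated_approx e (~` A).
Proof.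
move=> [Z1 [Z0 [t [t0 mZ1 mZ0 Z10 [A1 A0]]]]]; exists Z0, Z1, t; split=> //.
  by move=> x y ? ?; rewrite metric_sym; exact: Z10.
by rewrite setCK.
Qed.

Lemma separated_approxU A B : measurable A -> measurable B ->
  (forall e, 0 < e -> separated_approx e A) ->
  (forall e, 0 < e -> separated_approx e B) ->
  forall e, 0 < e -> separated_approx e (A `|` B).
Proof.
move=> mA mB sA sB e e0; have e20 : 0 < e / 2 by rewrite divr_gt0.
have [Z1 [Z0 [t [t0 mZ1 mZ0 Z10 [A1 A0]]]]] := sA _ e20.
have [Y1 [Y0 [u [u0 mY1 mY0 Y10 [B1 B0]]]]] := sB _ e20.
have ltU (C D E : set X) : measurable C -> measurable D -> measurable E ->
    E `<=` C `|` D ->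
    (mu C < (e / 2)%:E)%E -> (mu D < (e / 2)%:E)%E -> (mu E < e%:E)%E.
  move=> mC mD mE ECD C2 D2.
  apply: (@le_lt_trans _ _ (mu (C `|` D))).
    by apply: le_measure; rewrite ?inE//; exact: measurableU.
  apply: (le_lt_trans (measureU2 mu mC mD)).
  by rewrite [e in ltRHS]splitr EFinD lteD.
exists (Z1 `|` Y1), (Z0 `&` Y0), (Num.min t u); split.
- by rewrite lt_min t0.
- exact: measurableU.
- exact: measurableI.
- move=> x y [Zx|Yx] [Zy Yy]; rewrite ge_min.
    by rewrite Z10.
  by rewrite Y10 ?orbT.
have mC (C D : set X) : measurable C -> measurable D -> measurable (C `\` D).
  exact: measurableD.
split.
- apply: (ltU (A `\` Z1) (B `\` Y1)) => //; try exact: mC.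
    by apply: mC; exact: measurableU.
  by move=> x /= [[Ax|Bx] /not_orP[nZ nY]]; [left|right].
- apply: (ltU (~` A `\` Z0) (~` B `\` Y0)) => //.
  + by apply: mC => //; exact: measurableC.
  + by apply: mC => //; exact: measurableC.
  + by apply: mC; [apply/measurableC/measurableU|exact: measurableI].
  + by move=> x /= [/not_orP[nA nB] /not_andP[nZ|nY]]; [left|right].
Qed.

(** A finite union [B n] missing less than [e / 2] of the whole is approximated instead; its [Z0]
    serves unchanged, since the complement of the whole lies in that of [B n]. *)
Lemma separated_approx_bigcup (F : (set X)^nat) :
  (forall n, measurable (F n)) ->
  (forall n e, 0 < e -> separated_approx e (F n)) ->
  forall e, 0 < e -> separated_approx e (\bigcup_n F n).
Proof.
move=> mF sF e e0.
pose B n := \big[setU/set0]_(i < n) F i.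
have mB n : measurable (B n) by exact: bigsetU_measurable.
have sB n : forall e', 0 < e' -> separated_approx e' (B n).
  elim: n => [e' e'0|n IH e' e'0]; rewrite /B.
    rewrite big_ord0; exists set0, setT, 1; split => //.
    by rewrite set0D setDT measure0 lte_fin.
  by rewrite big_ord_recr; apply: separated_approxU => //; [exact: mB|exact: sF].
have mUF : measurable (\bigcup_n F n) by exact: bigcup_measurable.
have e20 : 0 < e / 2 by rewrite divr_gt0.
have BF n : B n `<=` \bigcup_n F n.
  by move=> x; rewrite /B -bigcup_mkord => -[i _ Fx]; exists i.
have BE : \bigcup_n B n = \bigcup_n F n.
  rewrite eqEsubset; split => x [n _]; first exact: BF.
  by move=> Fx; exists n.+1 => //; rewrite /B big_ord_recr/=; right.
have [|n] := exhaustion_lt mu mB _ e20.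
  by move=> m n mn; apply/subsetPset; exact: subset_bigsetU.
rewrite BE => Bn.
have [Z1 [Z0 [t [t0 mZ1 mZ0 Z10 [B1 B0]]]]] := sB n _ e20.
exists Z1, Z0, t; split => //; split.
- apply: (@le_lt_trans _ _ (mu ((\bigcup_n F n) `\` B n `|` (B n `\` Z1)))).
    apply: le_measure; rewrite ?inE.
    + exact: measurableD.
    + by apply: measurableU; exact: measurableD.
    + by move=> x [Fx nZ]; have [Bx|nBx] := pselect (B n x); [right|left].
  apply: le_lt_trans (measureU2 mu _ _) _; try exact: measurableD.
  by rewrite [e in ltRHS]splitr EFinD lteD.
- apply: (@le_lt_trans _ _ (mu (~` B n `\` Z0))).
    apply: le_measure; rewrite ?inE.
    + by apply: measurableD => //; exact: measurableC.
    + by apply: measurableD => //; exact: measurableC.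
    + by move=> x [nF nZ]; split => // /BF.
  by apply: lt_trans B0 _; rewrite lte_fin ltr_pdivrMr// ltr_pMr// ltr1n.
Qed.

Lemma open_borel A : open A -> measurable A.
Proof.
by move=> oA; rewrite (@borel_measurableE R d X); exact: sub_sigma_algebra.
Qed.

Lemma separated_approx_open A : open A ->
  forall e, 0 < e -> separated_approx e A.
Proof.
move=> oA e e0; have mA := open_borel oA.
(* The points at distance at least [1 / (n + 1)] from the complement of [A]: closed sets increasing
   to [A]. *)
pose F n := [set x : X | forall y, mdist x y < n.+1%:R^-1 -> A y].
have oF n : open (~` F n).
  rewrite openE => x /= /existsNP[y /not_implyP[xy nAy]].
  rewrite /interior nbhs_ballP; exists (n.+1%:R^-1 - mdist x y) => /=.
    by rewrite subr_gt0.
  move=> z; rewrite ballEmdist/= => xz; apply/existsNP; exists y.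
  apply/not_implyP; split => //.
  apply: le_lt_trans (metric_triangle _ x _) _.
  by rewrite -ltrBrDr metric_sym.
have mF n : measurable (F n) by rewrite -(setCK (F n)); exact/measurableC/open_borel.
have FA : \bigcup_n F n = A.
  apply/seteqP; split => x.
    by move=> [n _]; apply; rewrite mdistxx.
  move=> Ax; have := oA; rewrite openE => /(_ x Ax).
  rewrite /interior nbhs_ballP => -[r /= r0 rA].
  have [n _ nr] := near_infty_natSinv_lt (PosNum r0).
  exists n => // y xy; apply: rA; rewrite ballEmdist/=.
  exact: lt_trans xy (nr _ (leqnn n)).
have [|n] := exhaustion_lt mu mF _ e0.
  move=> m n mn; apply/subsetPset => x Fx y xy; apply: Fx.
  by apply: lt_le_trans xy _; rewrite lef_pV2 ?posrE// ler_nat.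
rewrite FA => An; exists (F n), (~` A), n.+1%:R^-1; split => //.
- exact: measurableC.
- by move=> x y Fx nAy; rewrite leNgt; apply/negP => /Fx.
- by split => //; rewrite setDv measure0 lte_fin.
Qed.

(** The approximable measurable sets form a sigma-algebra containing the open sets. *)
Lemma measurable_separated_approx A : measurable A ->
  forall e, 0 < e -> separated_approx e A.
Proof.
suff : <<s [set B : set X | open B] >> `<=`
    [set A | measurable A /\ forall e, 0 < e -> separated_approx e A].
  by rewrite -(@borel_measurableE R d X) => /[apply] -[].
apply: smallest_sub => /=.
  split=> [|B [mB sB]|F mF].
  - split=> [|e e0]; first exact: measurable0.
    by apply: separated_approx_open => //; exact: open0.
  - rewrite setTD; split; first exact: measurableC.
    by move=> e e0; exact/separated_approxC/sB.
  - split; first by apply: bigcup_measurable => n _; exact: (mF n).1.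
    by apply: separated_approx_bigcup => n; have [] := mF n.
by move=> B oB; split; [exact: open_borel|exact: separated_approx_open].
Qed.

End borel_metric.

(** * Measurability of Boolean conditions and of counts *)

Section measurable_bool.
Context (d : measure_display) (X : measurableType d).

Lemma measurable_bool_set (b : X -> bool) :
  measurable_fun [set: X] b -> measurable [set x | b x].
Proof. by move=> mb; rewrite -[X in measurable X]setTI; exact: mb. Qed.

Lemma measurable_implyb_set (b : X -> bool) (c : bool) :
  measurable [set x | b x] -> measurable [set x | b x ==> c].
Proof.
move=> mb; case: c.
  rewrite (_ : mkset _ = setT)//; apply/seteqP; split => // x _ /=.
  exact: implybT.
rewrite (_ : mkset _ = ~` [set x | b x]); first exact: measurableC.
by apply/seteqP; split => x /=; rewrite implybF => /negP.
Qed.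

End measurable_bool.

Section measurable_count.
Context (R : realType) (d : measure_display) (X : measurableType d).

Lemma measurable_count (I : Type) (P : I -> X -> bool) (s : seq I) :
  (forall i, measurable [set x | P i x]) ->
  measurable_fun [set: X] (fun x => (count (P ^~ x) s)%:R : R).
Proof.
move=> mP; rewrite (_ : (fun _ => _) = (fun x =>
    \sum_(i <- s) (\1_[set x | P i x] x : R))).
  by apply: measurable_sum => i; exact: measurable_indic.
apply/funext => x; rewrite -sum1_count natr_sum big_mkcond/=.
apply: eq_bigr => i _; rewrite indicE; case: ifPn => Pix; first by rewrite mem_set.
by rewrite memNset//; exact/negP.
Qed.

Lemma measurable_count_inv (I : Type) (P : I -> X -> bool) (s : seq I) :
  (forall i, measurable [set x | P i x]) ->
  measurable_fun [set: X] (fun x => (count (P ^~ x) s)%:R^-1 : R).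
Proof.
move=> mP; rewrite (_ : (fun _ => _) =
    (@powR R ^~ (-1)) \o (fun x => (count (P ^~ x) s)%:R)).
  by apply: measurableT_comp (measurable_powR _) _; exact: measurable_count.
by apply/funext => x /=; rewrite powR_inv1.
Qed.

End measurable_count.

(** * The cocycle of heights and the visit ratios *)

Section heights.
Context (R : realType) (d : measure_display) (X : measurableType d).
Variable mu : probability X R.
Context (G : groupType) (T : {multiplicative G -> automorphism mu}).
Implicit Types (g h k c : G) (x : X) (s : seq G) (t m : R).

Definition height g x : R := ln (derivative (aut_partial (T g)) x).

(** A conull set on which the chain rule holds for all [g] and [h] at once, so that identities
    between heights can be used pointwise. *)
Definition cocycle_points : set X := [set x | forall g h,
  0 < derivative (aut_partial (T g)) x /\
  derivative (aut_partial (T (g * h)%g)) x =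
  derivative (aut_partial (T g)) (T h x) * derivative (aut_partial (T h)) x].

Lemma actM g h x : T (g * h)%g x = T g (T h x).
Proof. by rewrite gmulfM. Qed.

Lemma act1 x : T 1%g x = x.
Proof.
suff -> : T 1%g = 1%g by [].
by apply: (@mulgI _ (T 1%g)); rewrite -gmulfM !mulg1.
Qed.

Lemma actK g x : T g^-1%g (T g x) = x.
Proof. by rewrite -actM mulVg act1. Qed.

Lemma measurable_act_preimage g (A : set X) :
  measurable A -> measurable (T g @^-1` A).
Proof.
by move=> mA; rewrite -[X in measurable X]setTI; exact: measurable_aut.
Qed.

(** The chain rule at [x] writes every derivative at [T g x] as a quotient of derivatives at [x]. *)
Lemma cocycle_points_act g x : cocycle_points x -> cocycle_points (T g x).
Proof.
move=> xP k h; have D0 j := (xP j 1%g).1; have DM j i := (xP j i).2.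
have DE j : derivative (aut_partial (T j)) (T g x) =
    derivative (aut_partial (T (j * g)%g)) x / derivative (aut_partial (T g)) x.
  by rewrite DM mulfK// gt_eqF.
split; first by rewrite DE divr_gt0.
rewrite !DE -actM (_ : derivative (aut_partial (T k)) (T (h * g)%g x) =
  derivative (aut_partial (T (k * (h * g))%g)) x /
  derivative (aut_partial (T (h * g)%g)) x).
  by rewrite mulgA mulrA divfK// gt_eqF.
by rewrite DM mulfK// gt_eqF.
Qed.

Lemma heightM g h x : cocycle_points x ->
  height (g * h) x = height g (T h x) + height h x.
Proof.
move=> xP; rewrite /height (xP g h).2 lnM ?posrE//; last exact: (xP h 1%g).1.
exact: (cocycle_points_act h xP g 1%g).1.
Qed.

Lemma height1 x : cocycle_points x -> height 1 x = 0.
Proof.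
by move=> /(heightM 1 1); rewrite mulg1 act1 => ?; lra.
Qed.

Lemma heightV g x : cocycle_points x -> height g^-1 (T g x) = - height g x.
Proof.
move=> xP; have := heightM g^-1 g xP; rewrite mulVg height1// => ?; lra.
Qed.

Lemma expR_height g x : cocycle_points x ->
  expR (height g x) = derivative (aut_partial (T g)) x.
Proof. by move=> xP; rewrite /height lnK// posrE; exact: (xP g 1%g).1. Qed.

Lemma measurable_height g : measurable_fun [set: X] (height g).
Proof.
by apply: measurableT_comp (measurable_derivative _); exact: measurable_ln.
Qed.

Lemma measurable_height_abs_le g t :
  measurable [set x | `|height g x| <= t].
Proof.
apply/measurable_bool_set/measurable_fun_ler => //.
by apply: measurableT_comp => //; exact: measurable_height.
Qed.

Lemma measurable_height_ge g m : measurable [set x | m <= height g x].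
Proof.
apply/measurable_bool_set/measurable_fun_ler => //; exact: measurable_height.
Qed.

Definition ncount t s x : nat := count (fun k => `|height k x| <= t) s.

(** Heights are bounded on one side only: seen from the visited point [T k x], the point [x] has
    height at most [m], which is the condition in [sum_expR_cluster]. *)
Definition hcount (Q : set X) m s x : nat :=
  count (fun k => (- m <= height k x) && (T k x \in Q)) s.

Lemma measurable_hcount Q m s : measurable Q ->
  measurable_fun [set: X] (fun x => (hcount Q m s x)%:R : R).
Proof.
move=> mQ.
apply: (@measurable_count _ _ _ G
  (fun k x => (- m <= height k x) && (T k x \in Q))) => k.
rewrite (_ : [set _ | _] = [set x | - m <= height k x] `&` T k @^-1` Q).
  by apply: measurableI; [exact: measurable_height_ge|exact: measurable_act_preimage].
apply/seteqP; split => x /=; first by move=> /andP[? /set_mem].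
by move=> [-> /mem_set].
Qed.

Definition translate s c : seq G := [seq (k * c^-1)%g | k <- s].

Definition hratio (Q : set X) m t s x : R :=
  (hcount Q m s x)%:R / (ncount t s x)%:R.

Lemma measurable_hratio Q m t s : measurable Q ->
  measurable_fun [set: X] (hratio Q m t s).
Proof.
move=> mQ; apply: measurable_funM; first exact: measurable_hcount.
apply: (@measurable_count_inv _ _ _ G (fun k x => `|height k x| <= t)) => k.
exact: measurable_height_abs_le.
Qed.

Lemma hratio_ge0 Q m t s x : 0 <= hratio Q m t s x.
Proof. exact: divr_ge0. Qed.

Lemma translate_uniq s c : uniq s -> uniq (translate s c).
Proof. by move=> us; rewrite map_inj_uniq//; exact: mulIg. Qed.

Lemma ncount_gt0 t s c x : 0 <= t -> c \in s -> cocycle_points x ->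
  (0 < ncount t (translate s c) x)%N.
Proof.
move=> t0 cs xP; rewrite -has_count; apply/hasP; exists 1%g.
  by apply/mapP; exists c; rewrite ?mulgV.
by rewrite height1 ?normr0.
Qed.

(** [K1] collects the exceptional [g]; [K2] ensures that they are at most half of those with small
    height at [x]. Every other such [g] gives a visit to [Q] from [x] or from [y]. *)
Lemma hratio_lower (C : {fset G}) c (K1 K2 : seq G) (Q : set X) t m (L : R) x y :
  c \in C -> cocycle_points x -> cocycle_points y -> 0 <= t -> t <= m -> 0 < L ->
  (forall g, g \notin K1 -> `|height g x| <= t ->
    - m <= height g y /\ (Q (T g x) \/ Q (T g y))) ->
  (forall g, g \notin K1 -> `|height g y| <= t -> - m <= height g x) ->
  uniq K2 -> {subset K2 <= translate C c} ->
  (2 * size K1 <= count (fun g => `|height g x| <= t)%R K2)%N ->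
  1 <= 2 * hratio Q m t (translate C c) x +
    L^-1 * hratio setT m t (translate C c) x +
    4 * L * hratio Q m t (translate C c) y.
Proof.
move=> cC xP yP t0 tm L0 H1 H2 uK2 K2C K12.
set s := translate C c.
have us : uniq s by exact/translate_uniq/fset_uniq.
pose nx := ncount t s x; pose ny := ncount t s y.
pose a := hcount Q m s x; pose b := hcount Q m s y; pose p := hcount setT m s x.
have cK1 : (count (mem K1) s <= size K1)%N.
  rewrite -size_filter uniq_leq_size ?filter_uniq// => g.
  by rewrite mem_filter => /andP[].
have nxP : (2 * size K1 <= nx)%N.
  by apply: leq_trans K12 _; exact: count_uniq_subset.
have hmx g : `|height g x| <= t -> - m <= height g x.
  by rewrite ler_norml => /andP[+ _]; apply: le_trans; rewrite lerN2.
have nxp : (nx <= p)%N.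
  by apply: sub_count => g gt; rewrite in_setT andbT hmx.
have nxab : (nx <= size K1 + (a + b))%N.
  apply: leq_trans (leq_add cK1 (leqnn _)).
  rewrite /a /b /hcount -(count_predUI _ _ s).
  apply: leq_trans (leq_add (leqnn _) (leq_addr _ _)).
  rewrite -count_predUI; apply: leq_trans (leq_addr _ _).
  apply: sub_count => g gt /=; have [//|gK1/=] := boolP (g \in K1).
  have [hgy [Qx|Qy]] := H1 _ gK1 gt; first by rewrite hmx// mem_set.
  by rewrite hgy (mem_set Qy) orbT.
have nyp : (ny <= size K1 + p)%N.
  apply: leq_trans (leq_add cK1 (leqnn _)).
  rewrite /p /hcount -count_predUI; apply: leq_trans (leq_addr _ _).
  apply: sub_count => g gt /=; have [//|gK1/=] := boolP (g \in K1).
  by rewrite in_setT andbT; exact: H2.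
have nx0 : 0 < nx%:R :> R by rewrite ltr0n ncount_gt0.
have ny0 : 0 < ny%:R :> R by rewrite ltr0n ncount_gt0.
have nxab' : nx%:R <= 2 * a%:R + 2 * b%:R :> R.
  by rewrite -!natrM -natrD ler_nat; lia.
have nyp' : ny%:R <= 2 * p%:R :> R by rewrite -natrM ler_nat; lia.
have al0 : 0 <= hratio Q m t s x by exact: hratio_ge0.
have be0 : 0 <= hratio Q m t s y by exact: hratio_ge0.
have pi0 : 0 <= hratio setT m t s x by exact: hratio_ge0.
have aE : a%:R = hratio Q m t s x * nx%:R by rewrite /hratio divfK// gt_eqF.
have bE : b%:R = hratio Q m t s y * ny%:R by rewrite /hratio divfK// gt_eqF.
have pE : p%:R = hratio setT m t s x * nx%:R by rewrite /hratio divfK// gt_eqF.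
move: al0 be0 pi0 aE bE pE.
set al := hratio Q m t s x; set be := hratio Q m t s y; set pi := hratio setT m t s x.
move=> al0 be0 pi0 aE bE pE.
(* Visits from [y] are measured against [ny], which is compared with [nx] through [ny <= 2 * p] and
   [p = pi * nx]. *)
have main : 1 <= 2 * al + 4 * (pi * be).
  rewrite -(ler_pM2r nx0) mul1r; apply: le_trans nxab' _.
  have : b%:R <= be * (2 * p%:R) by rewrite bE ler_wpM2l.
  rewrite pE aE; nra.
(* Averages of [pi] and [be] will be controlled, not those of their product: if [pi >= L], the term
   [L^-1 * pi] suffices; otherwise [pi * be <= L * be]. *)
have [Lpi|piL] := leP L pi.
  have : 1 <= L^-1 * pi by rewrite mulrC ler_pdivlMr// mul1r.
  have : 0 <= L * be by rewrite mulr_ge0// ltW.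
  lra.
have : 0 <= L^-1 * pi by rewrite mulr_ge0// invr_ge0 ltW.
have : pi * be <= L * be by rewrite ler_wpM2r// ltW.
lra.
Qed.

(** * Mass transport along orbits *)

Hypothesis cG : countable [set: G].

Lemma ae_cocycle_points : {ae mu, forall x, cocycle_points x}.
Proof.
apply: ae_forall_countable => // g; apply: ae_forall_countable => // h.
apply: filterS2 (derivative_gt0 (T g)) (derivative_aut_mul (T g) (T h)) => x.
by rewrite gmulfM.
Qed.

Lemma measurable_cocycle_points : measurable cocycle_points.
Proof.
have -> : cocycle_points = \bigcap_g \bigcap_h
  ([set x | 0 < derivative (aut_partial (T g)) x] `&`
   [set x | derivative (aut_partial (T (g * h)%g)) x =
  derivative (aut_partial (T g)) (T h x) * derivative (aut_partial (T h)) x]).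
  apply/seteqP; split => x /= xP; first by move=> g _ h _; exact: xP.
  by move=> g h; exact: xP.
have mT g := measurable_derivative (aut_partial (T g)).
apply: countable_bigcapT_measurable => // g.
apply: countable_bigcapT_measurable => // h.
apply: measurableI; first exact/measurable_bool_set/measurable_fun_ltr.
rewrite (_ : mkset _ = [set x | derivative (aut_partial (T (g * h)%g)) x ==
  derivative (aut_partial (T g)) (T h x) * derivative (aut_partial (T h)) x]).
  apply/measurable_bool_set/measurable_fun_eqr => //.
  apply: measurable_funM => //.
  by apply: measurableT_comp (measurable_aut (T h)).
by apply/seteqP; split => x /= /eqP.
Qed.

(* Mass transport: every point [x] spreads the weight [hratio Q m t _ x] over
   its images in [Q]; seen from an image point [z], the weight received is
   bounded by [sum_expR_cluster]. *)
Lemma sum_integral_hratio Q m t s : measurable Q -> 0 < t ->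
  (\sum_(c <- s) \int[mu]_x (hratio Q m t (translate s c) x)%:E <=
   (cluster_const m t * (size s)%:R)%:E * mu Q)%E.
Proof.
move=> mQ t0.
have mX0 : measurable cocycle_points by exact: measurable_cocycle_points.
pose hQ c b := cocycle_points `&`
  ([set x | - m <= height (b * c^-1) x] `&` T (b * c^-1)%g @^-1` Q).
have mhQ c b : measurable (hQ c b).
  apply: measurableI => //; apply: measurableI; first exact: measurable_height_ge.
  exact: measurable_act_preimage.
(* The weight that [x] sends to [T (b * c^-1) x]. *)
pose u c b x : R := \1_(hQ c b) x / (ncount t (translate s c) x)%:R.
have mu_ c b : measurable_fun [set: X] (u c b).
  apply: measurable_funM; first exact: measurable_indic.
  apply: (@measurable_count_inv _ _ _ G (fun k x => `|height k x| <= t)) => k.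
  exact: measurable_height_abs_le.
have u0 c b x : 0 <= u c b x by exact: divr_ge0.
(* The weight that [z] receives from [T (c * b^-1) z], times the density of the change of
   variables. *)
pose v c b z : R := u c b (T (c * b^-1)%g z) *
  derivative (aut_partial (T (c * b^-1)%g)) z.
have mv c b : measurable_fun [set: X] (v c b).
  apply: measurable_funM; last exact: measurable_derivative.
  by apply: measurableT_comp (measurable_aut _); exact: mu_.
have uv c b : (\int[mu]_x (u c b x)%:E = \int[mu]_x (v c b x)%:E)%E.
  rewrite -(integral_comp_derivative (T (c * b^-1)%g)).
  - by apply: eq_integral => x _; rewrite EFinM.
  - exact/measurable_EFinP.
  - by move=> x; rewrite lee_fin.
have bcK c b : (b * c^-1)%g = (c * b^-1)^-1%g by rewrite invgM invgK.
have vE c b z : cocycle_points z -> v c b z =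
    if (height (c * b^-1) z <= m) && (z \in Q) then
    expR (height (c * b^-1) z) /
    (count (fun k => `|height (k * b^-1) z - height (c * b^-1) z| <= t) s)%:R
    else 0.
  move=> zP; have yP := cocycle_points_act (c * b^-1)%g zP.
  rewrite /v /u -expR_height// indicE.
  have -> : (T (c * b^-1)%g z \in hQ c b) = (height (c * b^-1) z <= m) && (z \in Q).
    rewrite /hQ !in_setI (mem_set yP)/= bcK; congr (_ && _).
      apply/idP/idP; first by move=> /set_mem/=; rewrite heightV// lerN2.
      by move=> zm; apply/mem_set; rewrite /= heightV// lerN2.
    have -> : (T (c * b^-1)%g z \in T (c * b^-1)^-1%g @^-1` Q) =
        (T (c * b^-1)^-1%g (T (c * b^-1)%g z) \in Q).
      by apply/idP/idP => /set_mem zQ; exact/mem_set.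
    by rewrite actK.
  case: ifP => _; last by rewrite !mul0r.
  rewrite mul1r mulrC; congr (_ / _%:R); rewrite /ncount /translate count_map.
  apply: eq_count => k /=.
  (* Heights near [0] seen from [T (c * b^-1) z] are, seen from [z], heights near that of
     [c * b^-1]. *)
  rewrite (_ : (k * b^-1 = (k * c^-1) * (c * b^-1))%g); last first.
    by rewrite mulgA mulgVK.
  by rewrite (heightM (k * c^-1)%g (c * b^-1)%g zP) addrK.
have vN c b z : ~ cocycle_points z -> v c b z = 0.
  move=> nz; rewrite /v /u indicE memNset ?mul0r// => -[].
  move=> /(cocycle_points_act (c * b^-1)^-1%g).
  by rewrite actK.
have v0 c b z : 0 <= v c b z.
  have [zP|/vN->//] := pselect (cocycle_points z).
  rewrite vE//; case: ifP => _; last exact: lexx.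
  by apply: divr_ge0; rewrite ?expR_ge0.
have ratioE c : (\int[mu]_x (hratio Q m t (translate s c) x)%:E =
    \sum_(b <- s) \int[mu]_x (v c b x)%:E)%E.
  under eq_bigr do rewrite -uv.
  rewrite -ge0_integral_sum//; last 2 first.
  - by move=> b; exact/measurable_EFinP.
  - by move=> b x _; rewrite lee_fin.
  apply: ae_eq_integral => //.
  - exact/measurable_EFinP/measurable_hratio.
  - by apply: emeasurable_sum => b; exact/measurable_EFinP.
  - apply: filterS (ae_cocycle_points) => x xP _.
    rewrite sumEFin; congr EFin; rewrite /u -mulr_suml /hratio; congr (_ / _).
    rewrite /hcount /translate count_map -sum1_count natr_sum big_mkcond/=.
    apply: eq_bigr => b _; rewrite indicE /hQ !in_setI (mem_set xP)/=.
    rewrite (_ : (x \in [set _ | _]) = (- m <= height (b * c^-1) x)); last first.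
      by apply/idP/idP => [/set_mem//|?]; exact/mem_set.
    rewrite (_ : (x \in T (b * c^-1)%g @^-1` Q) = (T (b * c^-1)%g x \in Q)).
      by case: ifP.
    by apply/idP/idP => /set_mem ?; exact/mem_set.
under eq_bigr do rewrite ratioE.
(* For fixed [b], the sum over [c] is the one in [sum_expR_cluster] for the heights of the
   [c * b^-1] at [z]. *)
rewrite exchange_big/=.
rewrite [leRHS](_ : _ = \sum_(b <- s) ((cluster_const m t)%:E * mu Q))%E; last first.
  rewrite -[mu Q]fineK ?fin_num_measure// -!EFinM sumEFin big_const_seq count_predT.
  by congr EFin; rewrite iter_addr_0 -[RHS]mulr_natr mulrAC.
apply: lee_sum => b _.
rewrite -ge0_integral_sum//; last 2 first.
- by move=> c; exact/measurable_EFinP.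
- by move=> c x _; rewrite lee_fin.
have -> : ((cluster_const m t)%:E * mu Q =
    \int[mu]_x (cluster_const m t * \1_Q x)%:E)%E.
  under eq_integral do rewrite EFinM.
  rewrite ge0_integralZl//.
  - by rewrite integral_indic// setIT.
  - exact/measurable_EFinP/measurable_indic.
  by rewrite lee_fin cluster_const_ge0.
apply: ge0_le_integral => //.
- by move=> x _; rewrite sumEFin lee_fin sumr_ge0.
- by apply: emeasurable_sum => c; exact/measurable_EFinP.
- by apply/measurable_EFinP/measurable_funM => //; exact: measurable_indic.
- move=> z _; rewrite sumEFin lee_fin.
  have [zP|/vN nz] := pselect (cocycle_points z); last first.
    rewrite big1; last by move=> c _; exact: nz.
    by apply: mulr_ge0 => //; exact: cluster_const_ge0.
  under eq_bigr do rewrite vE//.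
  rewrite indicE; case: (z \in Q); last first.
    by rewrite big1 ?mulr0// => c _; rewrite andbF.
  under eq_bigr do rewrite andbT.
  rewrite -big_mkcond mulr1/=.
  have := @sum_expR_cluster R [seq height (c * b^-1) z | c <- s] m t t0.
  rewrite big_map; apply: le_trans; apply: ler_sum => c _.
  by rewrite count_map.
Qed.

(** For averaging the right side of [hratio_lower] with [y = W x]: the derivative turns integration
    at [W x] into integration at [x], and its absolute value keeps the integrand nonnegative
    everywhere. *)
Lemma sum_integral_test (W : automorphism mu) (C : {fset G}) (Q : set X)
    t m (a b e : R) :
  measurable Q -> 0 < t -> 0 <= a -> 0 <= b -> 0 <= e ->
  (\sum_(c <- C) \int[mu]_x (a * hratio Q m t (translate C c) x +
     b * hratio setT m t (translate C c) x +
     e * (hratio Q m t (translate C c) (W x) *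
          `|derivative (aut_partial W) x|))%:E <=
   ((a * fine (mu Q) + b + e * fine (mu Q)) * cluster_const m t *
     (size C)%:R)%:E)%E.
Proof.
move=> mQ t0 a0 b0 e0; pose w x := `|derivative (aut_partial W) x|.
set J := cluster_const m t.
have mr B c : measurable B ->
    measurable_fun setT (fun x => (hratio B m t (translate C c) x)%:E).
  by move=> mB; exact/measurable_EFinP/measurable_hratio.
have mw : measurable_fun [set: X] w.
  by apply: measurableT_comp => //; exact: measurable_derivative.
have mrw c : measurable_fun setT
    (fun x => (hratio Q m t (translate C c) (W x) * w x)%:E).
  apply/measurable_EFinP/measurable_funM => //.
  by apply: measurableT_comp (measurable_aut W); exact: measurable_hratio.
have r0 B c x : (0 <= (hratio B m t (translate C c) x)%:E)%E.
  by rewrite lee_fin hratio_ge0.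
have rw0 c x : (0 <= (hratio Q m t (translate C c) (W x) * w x)%:E)%E.
  by rewrite lee_fin; apply: mulr_ge0; [exact: hratio_ge0|exact: normr_ge0].
have intE c : (\int[mu]_x (a * hratio Q m t (translate C c) x +
     b * hratio setT m t (translate C c) x +
     e * (hratio Q m t (translate C c) (W x) * w x))%:E =
  a%:E * \int[mu]_x (hratio Q m t (translate C c) x)%:E +
  b%:E * \int[mu]_x (hratio setT m t (translate C c) x)%:E +
  e%:E * \int[mu]_x (hratio Q m t (translate C c) x)%:E)%E.
  transitivity (\int[mu]_x (a%:E * (hratio Q m t (translate C c) x)%:E +
     b%:E * (hratio setT m t (translate C c) x)%:E +
     e%:E * (hratio Q m t (translate C c) (W x) * w x)%:E))%E; first by [].
  rewrite ge0_integralD//; last 4 first.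
  - by move=> x _; rewrite adde_ge0// mule_ge0.
  - by apply: emeasurable_funD; apply: measurable_funeM; exact: mr.
  - by move=> x _; rewrite mule_ge0.
  - exact: measurable_funeM.
  rewrite ge0_integralD//; last 4 first.
  - by move=> x _; rewrite mule_ge0.
  - by apply: measurable_funeM; exact: mr.
  - by move=> x _; rewrite mule_ge0.
  - by apply: measurable_funeM; exact: mr.
  rewrite !ge0_integralZl//; try exact: mr.
  congr (_ + _ * _)%E.
  rewrite -[RHS](integral_comp_derivative W)//; last exact: mr.
  apply: ae_eq_integral => //.
    apply: emeasurable_funM; last exact/measurable_EFinP/measurable_derivative.
    apply/measurable_EFinP.
    by apply: measurableT_comp (measurable_aut W); exact: measurable_hratio.
  have := derivative_gt0 W; apply: filterS => x W0 _.
  by rewrite /w gtr0_norm// EFinM.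
under eq_bigr do rewrite -/(w _) intE.
have qE : mu Q = (fine (mu Q))%:E by rewrite fineK// fin_num_measure.
have SQ := sum_integral_hratio m C mQ t0.
have ST := sum_integral_hratio m C measurableT t0.
rewrite probability_setT mule1 in ST; rewrite qE -EFinM in SQ.
have int0 B c : (0 <= \int[mu]_x (hratio B m t (translate C c) x)%:E)%E.
  by apply: integral_ge0.
rewrite !big_split/= -!ge0_sume_distrr//.
apply: (@le_trans _ _ (a%:E * (J * (size C)%:R * fine (mu Q))%:E +
  b%:E * (J * (size C)%:R)%:E + e%:E * (J * (size C)%:R * fine (mu Q))%:E)%E).
  by apply: leeD; [apply: leeD|]; apply: lee_wpmul2l; rewrite ?lee_fin.
rewrite -!EFinM -!EFinD lee_fin le_eqVlt; apply/orP; left; apply/eqP; ring.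
Qed.

(** * Foelner averages and recurrence of small heights *)

Hypothesis aG : amenable R G.

(** For at least half of the [c] in [C], the set [C c^-1] contains [K]; each of these contributes at
    least [a * mu F], whence the factor [2]. *)
Lemma folner_average_le (K : seq G) (F : set X) (a B : R)
    (f : {fset G} -> G -> X -> \bar R) :
  measurable F -> 0 <= a ->
  (forall C c, measurable_fun [set: X] (f C c)) ->
  (forall C c x, 0 <= f C c x)%E ->
  (forall (C : {fset G}) c x, F x -> c \in C -> {subset K <= translate C c} ->
    a%:E <= f C c x)%E ->
  (forall C : {fset G}, \sum_(c <- C) \int[mu]_x f C c x <=
    (B * (size C)%:R)%:E)%E ->
  (a%:E * mu F <= (2 * B)%:E)%E.
Proof.
move=> mF a0 mf f0 af fB.
have e0 : 0 < 2^-1 :> R by rewrite invr_gt0.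
have [C C0 CP] := folner_seq aG K e0.
pose typ c := all (fun k => (k * c)%g \in C) K.
have typC : (size C)%:R <= 2 * (count typ C)%:R :> R.
  move: CP; rewrite -[in leRHS](count_predC typ C).
  rewrite -[in X in _ -> X](count_predC typ C).
  rewrite !natrD /typ /predC /=; lra.
rewrite -[mu F]fineK ?fin_num_measure//; set q := fine (mu F).
have q0 : 0 <= q by exact/fine_ge0/measure_ge0.
have aqF c : c \in C -> typ c -> ((a * q)%:E <= \int[mu]_x f C c x)%E.
  move=> cC tc; apply: (@le_trans _ _ (\int[mu]_x (a * \1_F x)%:E)%E).
    under eq_integral do rewrite EFinM.
    rewrite ge0_integralZl//.
    - by rewrite integral_indic// setIT EFinM /q fineK// fin_num_measure.
    - exact/measurable_EFinP/measurable_indic.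
  apply: ge0_le_integral => //.
  - by move=> x _; rewrite lee_fin mulr_ge0.
  - by apply/measurable_EFinP/measurable_funM => //; exact: measurable_indic.
  - move=> x _; rewrite indicE.
    have [xF|_] := boolP (x \in F); last by rewrite mulr0.
    rewrite mulr1; apply: af => //; first exact: set_mem.
    move=> k kK; have kcC := allP tc k kK.
    by apply/mapP; exists (k * c)%g; rewrite ?mulgK.
have : (((count typ C)%:R * (a * q))%:E <= (B * (size C)%:R)%:E)%E.
  apply: le_trans (fB C).
  rewrite [leRHS](bigID typ)/= (le_trans _ (leeDl _ _))//; last first.
    by apply: sume_ge0 => c _; exact: integral_ge0.
  rewrite big_seq_cond.
  apply: (@le_trans _ _ (\sum_(c <- C | (c \in C) && typ c) (a * q)%:E)%E).
    rewrite -big_seq_cond sumEFin big_const_seq iter_addr_0 lee_fin.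
    by rewrite -[leRHS]mulr_natl.
  by apply: lee_sum => c /andP[cC tc]; exact: aqF.
rewrite -EFinM !lee_fin => H.
have C0' : 0 < (size C)%:R :> R by rewrite ltr0n.
rewrite -(ler_pM2r C0') -mulrA.
rewrite -mulrA; apply: le_trans (_ : 2 * (B * (size C)%:R) <= _).
  apply: le_trans (_ : 2 * ((count typ C)%:R * (a * q)) <= _).
    by rewrite mulrA [leRHS]mulrA [leRHS]mulrC ler_wpM2l// mulr_ge0.
  by rewrite ler_pM2l.
by rewrite mulrA.
Qed.

(** With finitely many heights near [0] but infinitely many [>= 0], the ratios over [C c^-1] would
    become arbitrarily large, while their averages stay below [cluster_const 0 t]. *)
Lemma ae_finite_height_ge0 t : 0 < t -> {ae mu, forall x,
  finite_set [set g | `|height g x| <= t] ->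
  finite_set [set g | 0 <= height g x]}.
Proof.
move=> t0; have [K [uK ndK exK]] := exhausting_seqs (1%g : G) cG.
pose J := cluster_const 0 t; have J0 : 0 <= J := cluster_const_ge0 0 t0.
have mX0 : measurable cocycle_points by exact: measurable_cocycle_points.
suff aeK N : {ae mu, forall x, cocycle_points x ->
    (forall g, `|height g x| <= t -> g \in K N) ->
    finite_set [set g | 0 <= height g x]}.
  have := @ae_foralln _ _ _ mu _ aeK.
  apply: filterS2 (ae_cocycle_points) => x xP xK.
  move=> /finite_set_seq[s sP]; have [N sN] := exK s.
  by apply: (xK N) => // g /sP/sN.
pose n0 := (size (K N)).+1.
pose E := cocycle_points `&` \bigcap_g [set x | (`|height g x| <= t) ==> (g \in K N)].
have mE : measurable E.
  apply: measurableI => //; apply: countable_bigcapT_measurable => // g.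
  apply: (@measurable_implyb_set _ _ (fun x => `|height g x| <= t)).
  exact: measurable_height_abs_le.
(* On [F L j] the ratio is at least [L] as soon as [C c^-1] contains [K j]. *)
pose F L j := E `&` [set x | (L * n0)%:R <=
  (count (fun g => 0 <= height g x) (K j))%:R :> R].
have mF L j : measurable (F L j).
  apply: measurableI => //; apply/measurable_bool_set/measurable_fun_ler => //.
  apply: (@measurable_count _ _ _ _ (fun g x => 0 <= height g x)) => // g.
  exact: measurable_height_ge.
have ndF L : nondecreasing_seq (F L).
  move=> i j ij; apply/subsetPset => x [Ex /= xi]; split => //=.
  by apply: le_trans xi _; rewrite ler_nat count_uniq_subset//; exact: ndK.
have FL L j : (L%:R%:E * mu (F L j) <= (2 * J)%:E)%E.
  apply: (@folner_average_le (K j) (F L j) L%:R J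
    (fun C c x => (hratio setT 0 t (translate C c) x)%:E)) => //.
  - by move=> C c; exact/measurable_EFinP/measurable_hratio.
  - by move=> C c x; rewrite lee_fin; exact: hratio_ge0.
  - move=> C c x [[xP xE] /= xL] cC KC; rewrite lee_fin.
    rewrite /hratio ler_pdivlMr ?ltr0n ?(ncount_gt0 (ltW t0))//.
    rewrite -natrM; apply: (@le_trans _ _ (L * n0)%:R).
      rewrite ler_nat leq_mul2l; apply/orP; right.
      rewrite /ncount -size_filter (leq_trans _ (leqnSn _))//.
      apply: uniq_leq_size; first exact/filter_uniq/translate_uniq/fset_uniq.
      by move=> g; rewrite mem_filter => /andP[gt _]; have /implyP/(_ gt) := xE g I.
    apply: (le_trans xL); rewrite ler_nat /hcount.
    apply: leq_trans (count_uniq_subset _ (uK j) KC) _.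
    by apply: sub_count => g; rewrite oppr0 in_setT andbT.
  - move=> C; have := sum_integral_hratio 0 C measurableT t0.
    by rewrite probability_setT mule1.
pose D := \bigcap_L \bigcup_j F L j.
have mUF L : measurable (\bigcup_j F L j) by exact: bigcup_measurable.
have mD : measurable D by exact: bigcapT_measurable.
exists D; split => //.
  apply/eqP; rewrite -measure_le0 leNgt; apply/negP => D0.
  pose q := fine (mu D).
  have qE : mu D = q%:E by rewrite /q fineK// fin_num_measure.
  have q0 : 0 < q by rewrite -lte_fin -qE.
  (* This [L] makes [L * (q / 2)] exceed the bound [2 * J] of [FL], while some [F L j] has measure
     above [q / 2]. *)
  have [L qL] : exists L : nat, 2 * J / (q / 2) < L%:R.
    by exists (Num.truncn (2 * J / (q / 2))).+1; rewrite truncnS_gt.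
  have L0 : 0 < L%:R :> R.
    apply: le_lt_trans qL; apply: divr_ge0; first exact: mulr_ge0.
    by rewrite ltW// divr_gt0.
  have [|j] := @exhaustion_gt _ _ _ mu (F L) (q / 2)%:E (mF L) (ndF L).
    apply: (@lt_le_trans _ _ (mu D)).
      by rewrite qE lte_fin ltr_pdivrMr// ltr_pMr// ltr1n.
    by apply: le_measure; rewrite ?inE//; apply: bigcap_inf.
  move=> qF; have := FL L j; apply/negP; rewrite -ltNge.
  apply: (@lt_trans _ _ (L%:R%:E * (q / 2)%:E)%E).
    by rewrite -EFinM lte_fin -ltr_pdivrMr// divr_gt0.
  by rewrite lte_pmul2l// lte_fin.
move=> x /= /not_implyP[xP /not_implyP[xK infx]] L _.
have [B BA LB] := infinite_set_fset (L * n0) infx.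
have [j Bj] := exK B; exists j => //; split.
  by split => // g _; apply/implyP/xK.
rewrite /= ler_nat; apply: leq_trans LB _.
have := count_uniq_subset (fun g => 0 <= height g x) (fset_uniq B) Bj.
apply: leq_trans; rewrite (eq_in_count (a2 := predT)) ?count_predT//.
Qed.

(* Otherwise the set of all heights along some orbits is bounded above, and the
   highest points of these orbits form a set with finitely many returns. *)
Lemma ae_infinite_height_small t : conservative T -> 0 < t ->
  {ae mu, forall x, infinite_set [set g | `|height g x| <= t]}.
Proof.
move=> consT t0; have [K [_ _ exK]] := exhausting_seqs (1%g : G) cG.
have mX0 : measurable cocycle_points by exact: measurable_cocycle_points.
(* The points where the height [0] of the identity is the highest of the orbit and is attained only
   within [K n]. *)
pose W n := cocycle_points `&` (\bigcap_g [set x | height g x <= 0] `&`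
  \bigcap_g [set x | (0 <= height g x) ==> (g \in K n)]).
have mW n : measurable (W n).
  apply: measurableI => //; apply: measurableI;
    apply: countable_bigcapT_measurable => // g.
    by apply/measurable_bool_set/measurable_fun_ler => //; exact: measurable_height.
  apply: (@measurable_implyb_set _ _ (fun x => 0 <= height g x)).
  exact: measurable_height_ge.
have W0 n : mu (W n) = 0%E.
  (* If [y] and [T g y] are in [W n], then [g^-1] has height [<= 0] at [T g y], so [g] has height
     [>= 0] at [y] and lies in [K n]: finitely many returns, against conservativity. *)
  apply/eqP; rewrite -measure_le0 leNgt; apply/negP => /(consT _ (mW n)); apply.
  apply: (sub_finite_set _ (finite_seq (K n))) => g /= Wg.
  have /set0P[z [[zP [hx _]] [y [yP [hy Ky]] yx]]] : W n `&` T g @` W n != set0.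
    by apply/eqP => W0; move: Wg; rewrite W0 measure0 ltxx.
  have /implyP := Ky g I; apply.
  have := hx g^-1%g I; rewrite /= -yx heightV// => ?; lra.
have aeW : {ae mu, forall x, forall n g, ~ W n (T g x)}.
  apply: ae_foralln => n; apply: ae_forall_countable => // g.
  exists (T g @^-1` W n); split.
  - exact: measurable_act_preimage.
  - by apply/aut_preimage_nonsingular.
  - by move=> x /= /contrapT.
apply: filterS3 (ae_cocycle_points) (ae_finite_height_ge0 t0) aeW.
move=> x xP xfin xW /xfin /finite_set_seq[s sP].
have s1 : (1%g : G) \in s by apply/sP; rewrite /= height1.
(* A highest point of the orbit lies in some [W n], which almost no orbit meets. *)
have [g gs gmax] := seq_argmax (height ^~ x) s1.
have g0 : 0 <= height g x by apply/sP.
have hE k : height k (T g x) = height (k * g) x - height g x.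
  by rewrite heightM// addrK.
have [n Kn] := exK [seq (k * g^-1)%g | k <- s].
apply: (xW n g); split; first exact: cocycle_points_act.
split => k _ /=.
  rewrite hE; have [k0|k0] := leP 0 (height (k * g) x); last lra.
  by rewrite subr_le0; apply/gmax/sP.
apply/implyP; rewrite hE => kg; apply/Kn/mapP; exists (k * g)%g.
  by apply/sP; rewrite /=; lra.
by rewrite mulgK.
Qed.

End heights.

(** * Comparison of the two ratio sets *)

Section ratio_sets.
Context (R : realType) (d : measure_display) (X : borelMetricType R d).
Variable mu : probability X R.
Context (G Gam : groupType) (T : {multiplicative G -> automorphism mu})
  (S : {multiplicative Gam -> automorphism mu}).
Hypotheses (sbX : standard_borel R X) (cG : countable [set: G])
  (aG : amenable R G) (consT : conservative T) (cGam : countable [set: Gam])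
  (asymTS : asymptotic T S).
Implicit Types (g h k : G) (x y : X) (E P : set X).
Local Notation height := (height T).
Local Notation X0 := (cocycle_points T).

Definition avoids (r eps : R) E x := X0 x /\ forall g h,
  E (T h x) -> E (T g (T h x)) -> eps <= `|height g (T h x) - r|.

Definition small_return (e : R) E : set X :=
  [set x | exists k, E (T k x) /\ `|height k x| < e].

Lemma measurable_small_return e E : measurable E ->
  measurable (small_return e E).
Proof.
move=> mE; rewrite (_ : small_return e E =
    \bigcup_k (T k @^-1` E `&` [set x | `|height k x| < e])).
  apply: countable_bigcupT_measurable => // k; apply: measurableI.
    exact: measurable_act_preimage.
  apply/measurable_bool_set/measurable_fun_ltr => //.
  by apply: measurableT_comp => //; exact: measurable_height.
by apply/seteqP; split => x /= [k]; exists k.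
Qed.

(* [small_return (eps / 2) E] is the slice at height [0] of the saturation of
   [E * ]-eps/2, eps/2[] in the Maharam extension; this saturation is disjoint
   from its translate by [r] when [E] avoids [r]. *)
Lemma avoids_not_small_return r eps E x g : avoids r eps E x -> E x ->
  `|height g x + r| <= eps / 2 -> ~ small_return (eps / 2) E (T g x).
Proof.
move=> [xP xE] Ex hg [k [Ek hk]].
have yP := cocycle_points_act g xP.
(* [(k * g)^-1] leads from [T k (T g x)] in [E] back to [x], at a height differing from [r] by less
   than [eps / 2 + eps / 2]. *)
have := xE (k * g)^-1%g (k * g)%g.
rewrite -actM mulVg act1 actM => /(_ Ek Ex); rewrite -actM heightV//.
rewrite heightM// => H; move: H hg hk.
by rewrite !ler_norml !ltr_norml ler_normr => *; lra.
Qed.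

Lemma small_return_act e E x g : X0 x -> E x -> `|height g x| < e ->
  small_return e E (T g x).
Proof.
by move=> xP Ex gE; exists g^-1%g; rewrite actK heightV// normrN.
Qed.

(** A [g] violating the bound on a non-null set would make [T g] itself a forbidden [V];
    nonsingularity carries the bound along orbits. *)
Lemma ae_avoids (r eps : R) E : measurable E ->
  ~ (exists2 V : partial_iso mu,
      {ae mu, forall x, pdom V x -> orbit_relation T x (V x)} &
      (0 < mu (pdom V `&` E `&` V @^-1` E `&`
               [set x | (`|ln (derivative V x) - r| < eps)%R]))%E) ->
  {ae mu, forall x, avoids r eps E x}.
Proof.
move=> mE noV.
have aeg g : {ae mu, forall x, E x -> E (T g x) -> eps <= `|height g x - r|}.
  pose N := setT `&` E `&` T g @^-1` E `&` [set x | `|height g x - r| < eps].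
  exists N; split.
  - apply: measurableI; last first.
      apply/measurable_bool_set/measurable_fun_ltr => //.
      apply: measurableT_comp => //; apply: measurable_funB => //.
      exact: measurable_height.
    by rewrite setTI; apply: measurableI => //; exact: measurable_act_preimage.
  - apply/eqP; rewrite -measure_le0 leNgt; apply/negP => N0; apply: noV.
    by exists (aut_partial (T g)) => //; apply: aeW => x _; exists g.
  - move=> x /= /not_implyP[Ex /not_implyP[EgE /negP]].
    by rewrite -ltNge.
have aegh : {ae mu, forall x, forall g h,
    E (T h x) -> E (T g (T h x)) -> eps <= `|height g (T h x) - r|}.
  apply: ae_forall_countable => // g; apply: ae_forall_countable => // h.
  exact: (ae_aut_comp (T h) (aeg g)).
by apply: filterS2 (ae_cocycle_points T cG) aegh => x xP xE.
Qed.

Lemma at_infinity_seq (A : set G) : at_infinity G A ->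
  exists s : seq G, forall g, g \notin s -> A g.
Proof.
move=> /finite_set_seq[s sP]; exists s => g /negP gs.
by apply: contrapT => nA; apply/gs/sP.
Qed.

(** By the chain rule, the last expression is the logarithm of the ratio in
    [renormalization_relation]; hence [height g (S gam x)] is about [height g x - r] outside the
    finite set [s]. *)
Definition near_shift (r e : R) E (gam : Gam) (s : seq G) : set X :=
  [set x | [/\ E x, E (S gam x), 0 < derivative (aut_partial (S gam)) x,
    `|ln (derivative (aut_partial (S gam)) x) - r| <= e &
    forall g, g \notin s -> `|height g (S gam x) - height g x +
      ln (derivative (aut_partial (S gam)) x)| <= e]].

Lemma measurable_near_shift r e E gam s : measurable E ->
  measurable (near_shift r e E gam s).
Proof.
move=> mE; pose lS x := ln (derivative (aut_partial (S gam)) x).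
have mlS : measurable_fun [set: X] lS.
  by apply: measurableT_comp (measurable_derivative _); exact: measurable_ln.
rewrite (_ : near_shift _ _ _ _ _ = E `&` S gam @^-1` E `&`
    [set x | 0 < derivative (aut_partial (S gam)) x] `&`
    [set x | `|lS x - r| <= e] `&`
    \bigcap_g [set x | (g \notin s) ==>
       (`|height g (S gam x) - height g x + lS x| <= e)]).
  apply: measurableI.
    apply: measurableI; first apply: measurableI.
    - by apply: measurableI => //; exact: measurable_act_preimage.
    - apply/measurable_bool_set/measurable_fun_ltr => //.
      exact: measurable_derivative.
    apply/measurable_bool_set/measurable_fun_ler => //.
    by apply: measurableT_comp => //; exact: measurable_funB.
  apply: countable_bigcapT_measurable => // g.
  have [gs|gs] := boolP (g \in s); rewrite /=.
    by rewrite (_ : mkset _ = setT)//; apply/seteqP.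
  apply/measurable_bool_set/measurable_fun_ler => //.
  apply: measurableT_comp => //; apply: measurable_funD => //.
  apply: measurable_funB; last exact: measurable_height.
  exact: measurableT_comp (measurable_height T g) (measurable_aut _).
apply/seteqP; split => x /=.
  by move=> [Ex ESx S0 xr xe]; split => // g _; apply/implyP/xe.
by move=> [[[[Ex ESx] S0] xr] xe]; split => // g gs; have /implyP := xe g I; apply.
Qed.

(** On countably many measurable pieces [V] agrees with some [S gam] and has its derivative;
    convergence of the ratio to [1] yields [s]. *)
Lemma ae_near_shift r e E (V : partial_iso mu) : 0 < e ->
  {ae mu, forall x, pdom V x -> renormalization_relation T S x (V x)} ->
  {ae mu, forall x, pdom V x -> E x -> E (V x) ->
    `|ln (derivative V x) - r| < e ->
    exists gam s, near_shift r e E gam s x}.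
Proof.
move=> e0 aeV.
have aeD : {ae mu, forall x gam, pdom V x -> V x = S gam x ->
    derivative V x = derivative (aut_partial (S gam)) x}.
  apply: ae_forall_countable => // gam.
  have mD := measurable_eq_standard_borel sbX (measurable_pdom V)
    (@measurable_pfun _ _ _ _ V) (measurable_funTS (measurable_aut (S gam))).
  have := @derivative_ae_eq_aut _ _ _ mu V (S gam) _ mD (@subIsetl _ _ _).
  have VS : {in pdom V `&` [set x | V x = S gam x], V =1 S gam}.
    by move=> x; rewrite inE => -[].
  by move=> /(_ VS); apply: filterS => x xD Dx VSx; apply: xD.
have aeS : {ae mu, forall x gam g, [/\ 0 < derivative (aut_partial (S gam)) x,
    X0 (S gam x) & derivative (aut_partial (T g * S gam)%g) x =
    derivative (aut_partial (T g)) (S gam x) *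
    derivative (aut_partial (S gam)) x]}.
  apply: ae_forall_countable => // gam; apply: ae_forall_countable => // g.
  have aeX := ae_aut_comp (S gam) (ae_cocycle_points T cG).
  apply: filterS3 (derivative_gt0 (S gam)) aeX (derivative_aut_mul (T g) (S gam)).
  by [].
have aeDS : {ae mu, forall x, X0 x /\ forall gam g,
  [/\ pdom V x -> V x = S gam x ->
     derivative V x = derivative (aut_partial (S gam)) x,
   0 < derivative (aut_partial (S gam)) x, X0 (S gam x) &
   derivative (aut_partial (T g * S gam)%g) x =
    derivative (aut_partial (T g)) (S gam x) *
    derivative (aut_partial (S gam)) x]}.
  apply: filterS3 (ae_cocycle_points T cG) aeD aeS => x xX xD xS.
  by split=> // gam g; have [] := xS gam g; split => //; exact: xD.
apply: filterS2 aeV aeDS => x xV [xX xS] Dx Ex EVx Vr.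
have [gam VS lim] := xV Dx.
have : (fun g => ln (derivative (aut_partial (T g * S gam)%g) x /
    derivative (aut_partial (T g)) x)) @ at_infinity G --> (ln 1 : R).
  by apply: continuous_cvg lim; exact: continuous_ln.
rewrite ln1 => /cvgrPdist_le /(_ _ e0) /at_infinity_seq[s sP].
exists gam, s; split => //; first by rewrite -VS.
    by have [] := xS gam 1%g.
  by have [xD _ _ _] := xS gam 1%g; rewrite -(xD Dx VS) ltW.
move=> g /sP; have [_ S0 XS ->] := xS gam g; rewrite sub0r normrN mulrAC.
have Dg : 0 < derivative (aut_partial (T g)) x by exact: (xX g 1%g).1.
have DgS : 0 < derivative (aut_partial (T g)) (S gam x) by exact: (XS g 1%g).1.
by rewrite lnM ?posrE ?divr_gt0// ln_div ?posrE.
Qed.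

Lemma ae_not_separated gam (Z1 Z0 : set X) (e : R) : 0 < e ->
  (forall x y, Z1 x -> Z0 y -> e <= mdist x y) ->
  {ae mu, forall x, exists s : seq G, forall g, g \notin s ->
    ~ (Z1 (T g x) /\ Z0 (T g (S gam x)))}.
Proof.
move=> e0 sep; apply: filterS (asymTS gam) => x /cvgrPdist_lt /(_ _ e0).
move=> /at_infinity_seq[s sP]; exists s => g /sP.
rewrite sub0r normrN ger0_norm ?mdist_ge0// => lte [Zx Zy].
by have := sep _ _ Zx Zy; rewrite leNgt lte.
Qed.

(** If this set had measure [p > 0], [hratio_lower] would apply with [y = S gam x] on a subset of
    measure above [p / 2], while the averages of its weighted right side are at most [p / 8]. *)
Lemma near_shift_null (r eps : R) E gam s : measurable E -> 0 < eps ->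
  {ae mu, forall x, avoids r eps E x} ->
  mu (near_shift r (eps / 8) E gam s) = 0%E.
Proof.
move=> mE eps0 aeA; set P := near_shift _ _ _ _ _.
have mP : measurable P by exact: measurable_near_shift.
apply/eqP; rewrite -measure_le0 leNgt; apply/negP => P0.
pose p := fine (mu P); have pE : mu P = p%:E by rewrite /p fineK// fin_num_measure.
have p0 : 0 < p by rewrite -lte_fin -pE.
(* A height at [x] of at most [eps / 4] and two errors of [eps / 8] keep [height g y + r] within the
   [eps / 2] of [avoids_not_small_return]. *)
pose t := eps / 4; have t0 : 0 < t by rewrite divr_gt0.
pose m : R := `|r| + eps; pose J := cluster_const m t.
have J0 : 0 <= J := cluster_const_ge0 m t0.
(* Chosen so that [L^-1 * J <= p / 16]. *)
pose L := 16 * (J + 1) / p.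
have L0 : 0 < L by rewrite divr_gt0// mulr_gt0//; lra.
(* On [P], [e1] times the derivative of [S gam] is at least [1], so this weight can be inserted. *)
pose e1 := expR (eps / 8 - r).
have e10 : 0 < e1 by exact: expR_gt0.
(* The coefficient of [mu Q] in the averaged bound; [q0] will make [M * mu Q] at most [p / 16]. *)
pose M := (2 + 4 * L * e1) * J.
have Le0 : 0 <= 4 * L * e1.
  by apply: mulr_ge0; [apply: mulr_ge0 => //|]; exact: ltW.
have M0 : 0 <= M by apply: mulr_ge0 => //; exact: addr_ge0.
pose q0 := p / 16 / (M + 1).
have q00 : 0 < q0 by rewrite divr_gt0 ?divr_gt0//; lra.
pose A := small_return (eps / 2) E.
have mA : measurable A by exact: measurable_small_return.
have q02 : 0 < q0 / 2 by rewrite divr_gt0.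
have [Z1 [Z0 [tau [tau0 mZ1 mZ0 sep [AZ1 AZ0]]]]] :=
  measurable_separated_approx mu mA q02.
(* If [T g x] is in [A], [T g y] is not, and their distance is below [tau], one of them is in
   [Q]. *)
pose Q := (A `\` Z1) `|` (~` A `\` Z0).
have mAZ1 : measurable (A `\` Z1) by exact: measurableD.
have mAZ0 : measurable (~` A `\` Z0) by apply: measurableD => //; exact: measurableC.
have mQ : measurable Q by exact: measurableU.
pose q := fine (mu Q); have qE : mu Q = q%:E by rewrite /q fineK// fin_num_measure.
have qq0 : q <= q0.
  rewrite -lee_fin -qE; apply: (le_trans (measureU2 mu mAZ1 mAZ0)).
  by rewrite [q0]splitr EFinD; apply: leeD; exact: ltW.
have [K [uK ndK exK]] := exhausting_seqs (1%g : G) cG.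
have [n sK] := exK s.
(* On a large part of [P], one finite set contains all [g] with [T g x] in [Z1] and [T g y] in
   [Z0]. *)
pose F1 i := P `&` \bigcap_g [set x | (g \notin K (n + i)%N) ==>
  ~~ ((T g x \in Z1) && (T g (S gam x) \in Z0))].
have mF1 i : measurable (F1 i).
  apply: measurableI => //; apply: countable_bigcapT_measurable => // g.
  case: (g \notin K (n + i)%N); last first.
    by rewrite (_ : mkset _ = setT)//; apply/seteqP.
  rewrite (_ : mkset _ = ~` (T g @^-1` Z1 `&` S gam @^-1` (T g @^-1` Z0))).
    apply: measurableC; apply: measurableI; first exact: measurable_act_preimage.
    by do 2!apply: measurable_act_preimage.
  apply/seteqP; split => x /=.
    by move=> /negP H [/mem_set z1 /mem_set z0]; apply: H; rewrite z1.
  by move=> H; apply/negP => /andP[/set_mem z1 /set_mem z0]; apply: H.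
have ndF1 : nondecreasing_seq F1.
  move=> i j ij; apply/subsetPset => x [Px xi]; split => // g _ /=.
  have /implyP := xi g I => H; apply/implyP => gj; apply: H.
  by apply: contra gj; apply: ndK; rewrite leq_add2l.
have [i pF1] : exists i, ((p / 2)%:E < mu (F1 i))%E.
  apply: exhaustion_gt => //; apply: (@lt_le_trans _ _ (mu P)).
    by rewrite pE lte_fin ltr_pdivrMr// ltr_pMr// ltr1n.
  apply: ae_le_measure => //; first exact: bigcup_measurable.
  apply: filterS (ae_not_separated gam tau0 sep) => x [s' s'P] Px.
  have [i s'K] := exK s'; exists i => //; split => // g _ /=.
  apply/implyP => gK; apply/negP => /andP[/set_mem z1 /set_mem z0].
  apply: (s'P g) => //; apply: contra gK => /s'K.
  by apply: ndK; rewrite leq_addl.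
pose K1 := K (n + i)%N.
(* [K j] must hold twice as many small heights as [K1] has elements; [ae_infinite_height_small]
   provides them. *)
pose F2 j := F1 i `&` [set x | (2 * size K1)%:R <=
  (count (fun g => `|height g x| <= t) (K j))%:R :> R].
have mF2 j : measurable (F2 j).
  apply: measurableI => //; apply/measurable_bool_set/measurable_fun_ler => //.
  apply: (@measurable_count _ _ _ _ (fun g x => `|height g x| <= t)) => // g.
  exact: measurable_height_abs_le.
have ndF2 : nondecreasing_seq F2.
  move=> j k jk; apply/subsetPset => x [Fx /= xj]; split => //=.
  by apply: le_trans xj _; rewrite ler_nat count_uniq_subset//; exact: ndK.
have [j pF2] : exists j, ((p / 2)%:E < mu (F2 j))%E.
  apply: exhaustion_gt => //; apply: (lt_le_trans pF1).
  apply: ae_le_measure => //; first exact: bigcup_measurable.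
  apply: filterS (ae_infinite_height_small cG aG consT t0) => x xinf Fx.
  have [B BA LB] := infinite_set_fset (2 * size K1) xinf.
  have [j Bj] := exK B; exists j => //; split => //=.
  rewrite ler_nat; apply: leq_trans LB _.
  have := count_uniq_subset (fun g => `|height g x| <= t) (fset_uniq B) Bj.
  by apply: leq_trans; rewrite (eq_in_count (a2 := predT)) ?count_predT.
have aeSA := ae_aut_comp (S gam) aeA.
have aeAA : {ae mu, forall x, avoids r eps E x /\ avoids r eps E (S gam x)}.
  by apply: filterS2 aeA aeSA.
have [N [mN N0 NA]] := aeAA.
pose F := F2 j `\` N.
have mF : measurable F by exact: measurableD.
have pF : ((p / 2)%:E < mu F)%E.
  apply: (lt_le_trans pF2); apply: ae_le_measure => //.
  exists N; split => // x /= /not_implyP[Fx nF].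
  by apply: contrapT => nN; apply: nF.
(* This gives [mu F <= p / 4], against [pF]. *)
have : (1%:E * mu F <= (2 * (p / 8))%:E)%E; last first.
  rewrite mul1e leNgt; move/negP; apply; apply: le_lt_trans pF.
  by rewrite lee_fin; lra.
pose f (C : {fset G}) c x : \bar R := (2 * hratio T Q m t (translate C c) x +
  L^-1 * hratio T setT m t (translate C c) x +
  4 * L * e1 * (hratio T Q m t (translate C c) (S gam x) *
    `|derivative (aut_partial (S gam)) x|))%:E.
apply: (@folner_average_le _ _ _ _ _ aG (K j) F 1 (p / 8) f) => //.
- move=> C c; apply/measurable_EFinP.
  have mh B : measurable B -> measurable_fun setT (hratio T B m t (translate C c)).
    exact: measurable_hratio.
  apply: measurable_funD.
    by apply: measurable_funD; apply: measurable_funM => //; exact: mh.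
  apply: measurable_funM => //; apply: measurable_funM.
    by apply: measurableT_comp (measurable_aut _); exact: mh.
  by apply: measurableT_comp => //; exact: measurable_derivative.
- move=> C c x; rewrite lee_fin; apply: addr_ge0; first apply: addr_ge0.
  + by apply: mulr_ge0 => //; exact: hratio_ge0.
  + by apply: mulr_ge0; [rewrite invr_ge0 ltW|exact: hratio_ge0].
  + by apply: mulr_ge0 => //; apply: mulr_ge0 => //; exact: hratio_ge0.
- move=> C c x [[[[Ex ESx W0 Wr hWx] xZ] xK2] nN] cC KC.
  have [[xP xE] [yP yE]] : avoids r eps E x /\ avoids r eps E (S gam x).
    by apply: contrapT => nA; apply/nN/NA.
  set y := S gam x in ESx hWx yP yE *.
  set W := derivative _ x in W0 Wr hWx *.
  move: Wr; rewrite ler_norml => /andP[Wr1 Wr2].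
  have hK1 g : g \notin K1 ->
      - (eps / 8) <= height g y - height g x + ln W <= eps / 8.
    move=> gK1; rewrite -ler_norml; apply: hWx; apply: contra gK1 => /sK.
    by apply: ndK; rewrite leq_addr.
  have rr : - `|r| <= r <= `|r| by rewrite -ler_norml.
  rewrite lee_fin.
  apply: le_trans (_ : 2 * hratio T Q m t (translate C c) x +
    L^-1 * hratio T setT m t (translate C c) x +
    4 * L * hratio T Q m t (translate C c) y <= _).
    apply: (@hratio_lower _ _ _ _ _ T C c K1 (K j)) => //.
    + exact: ltW.
    + by rewrite /m /t; move: rr; lra.
    + move=> g gK1 gt; have := hK1 _ gK1; move: (gt); rewrite ler_norml /t /m => *.
      split; first lra.
      have TgA : A (T g x).
        apply: small_return_act => //; apply: le_lt_trans gt _.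
        by rewrite /t; lra.
      have nTgA : ~ A (T g y).
        apply: (@avoids_not_small_return r eps) => //.
        by rewrite ler_norml; lra.
      have /implyP/(_ gK1)/negP nZ := xZ g I.
      have [z1|nz1] := pselect (Z1 (T g x)); last by left; left.
      right; right; split => // z0; apply: nZ.
      by rewrite (mem_set z1) (mem_set z0).
    + move=> g gK1; have := hK1 _ gK1; rewrite ler_norml /t /m => *; lra.
    + by move: xK2; rewrite /= ler_nat.
  have eW : 1 <= e1 * `|W|.
    rewrite gtr0_norm// -[W]lnK ?posrE// /e1 -expRD -[leLHS]expR0 ler_expR; lra.
  rewrite lerD2l (_ : 4 * L * e1 * _ =
    4 * L * hratio T Q m t (translate C c) y * (e1 * `|W|)); last by ring.
  apply: ler_peMr => //; apply: mulr_ge0; last exact: hratio_ge0.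
  by apply: mulr_ge0 => //; exact: ltW.
- move=> C; have Li0 : 0 <= L^-1 by rewrite invr_ge0 ltW.
  have H := sum_integral_test T cG (S gam) C m mQ t0 (ler0n R 2) Li0 Le0.
  apply: (le_trans H); rewrite lee_fin ler_wpM2r//.
  have LJ : L^-1 * J <= p / 16.
    rewrite mulrC ler_pdivrMr// (_ : p / 16 * L = J + 1); first lra.
    by rewrite /L; field; rewrite gt_eqF.
  have : M * q <= p / 16.
    apply: (@le_trans _ _ (M * q0)); first exact: ler_wpM2l.
    rewrite /q0 mulrCA ger_pMr ?divr_gt0// ler_pdivrMr; lra.
  move: LJ; rewrite /M /J /q; lra.
Qed.

(** If [r] failed for [E] and [eps], the points where a [V] serves [E] and [eps / 8] in the
    renormalization relation would be covered, up to a null set, by countably many null sets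
    [near_shift]. *)
Lemma renormalization_ratio_setS :
  ratio_set mu (renormalization_relation T S) `<=`
  ratio_set mu (orbit_relation T).
Proof.
move=> r rR E mE E0 eps eps0; apply: contrapT => noV.
have aeA := ae_avoids mE noV.
have e0 : 0 < eps / 8 by rewrite divr_gt0.
have [V aeV] := rR E mE E0 _ e0; apply/negP; rewrite -leNgt.
have [K [_ _ exK]] := exhausting_seqs (1%g : G) cG.
(* [near_shift] grows with [s], so the sets [K n] suffice as exceptional sets. *)
have aeP : {ae mu, forall x gam n, ~ near_shift r (eps / 8) E gam (K n) x}.
  apply: ae_forall_countable => // gam; apply: ae_foralln => n.
  exists (near_shift r (eps / 8) E gam (K n)); split.
  - exact: measurable_near_shift.
  - exact: near_shift_null.
  - by move=> x /= /contrapT.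
rewrite -(measure0 mu); apply: ae_le_measure => //.
  rewrite (_ : pdom V `&` E `&` V @^-1` E = E `&` (pdom V `&` V @^-1` E)).
    apply: measurableI; last first.
      apply/measurable_bool_set/measurable_fun_ltr => //.
      apply: measurableT_comp => //; apply: measurable_funB => //.
      apply: measurableT_comp (measurable_derivative V); exact: measurable_ln.
    apply: measurableI => //.
    by apply: (@measurable_pfun _ _ _ _ V) => //; exact: measurable_pdom.
  by rewrite -setIA setICA.
apply: filterS2 aeP (ae_near_shift r E e0 aeV) => x xP xV.
move=> [[[Dx Ex] EVx] Vr]; have [gam [s xs]] := xV Dx Ex EVx Vr.
have [n sn] := exK s; apply: (xP gam n).
case: xs => Ex' ESx S0 Sr xs; split => // g gK; apply: xs.
by apply: contra gK => /sn.
Qed.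

End ratio_sets.

Theorem theorem4p3 (R : realType) (d : measure_display)
    (X : borelMetricType R d) (mu : probability X R)
    (G Gam : groupType)
    (T : {multiplicative G -> automorphism mu})
    (S : {multiplicative Gam -> automorphism mu}) :
  standard_borel R X ->
  countable [set: G] -> infinite_set [set: G] -> amenable R G ->
  conservative T ->
  countable [set: Gam] -> asymptotic T S ->
  (ratio_set mu (renormalization_relation T S) = [set: R] ->
   ratio_set mu (orbit_relation T) = [set: R]) /\
  (ergodic T -> ratio_set mu (renormalization_relation T S) = [set: R] ->
   type_III1 T).
Proof.
move=> sbX cG _ aG consT cGam asymTS.
have RT : ratio_set mu (renormalization_relation T S) = [set: R] ->
    ratio_set mu (orbit_relation T) = [set: R].
  move=> RR; apply/seteqP; split => // r _.
  by apply: (renormalization_ratio_setS sbX cG aG consT cGam asymTS); rewrite RR.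
by split=> // ergT /RT.
Qed.
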